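(* Let $M$ be a positive integer and let $\vec{p}=(p_1,\ldots,p_M)\in(0,1)^M$ and $\vec{q}=(q_1,\ldots,q_M)\in(0,1)^M$ be cookie environments. If $\vec{p}\prec\vec{q}$, then either $v(\vec{p})=v(\vec{q})=0$ or $v(\vec{p})<v(\vec{q})$.
   Context: Excited random walk. For a positive integer $M$ and a cookie environment $\vec{p}=(p_1,\ldots,p_M)\in(0,1)^M$, the excited random walk $\{X_n\}_{n\ge 0}$ is the $\mathbb{Z}$-valued nearest-neighbor process with law $P_{\vec{p}}$ given by $P_{\vec{p}}(X_0=0)=1$ and, with $\mathcal{F}_n=\sigma(X_k,\ k\le n)$, $$P_{\vec{p}}(X_{n+1}=X_n+1\mid\mathcal{F}_n)=1-P_{\vec{p}}(X_{n+1}=X_n-1\mid\mathcal{F}_n)=\begin{cases}p_j & \text{if } \#\{k\le n: X_k=X_n\}=j \text{ with } 1\le j\le M,\\ 1/2 & \text{if } \#\{k\le n: X_k=X_n\}>M.\end{cases}$$ Limiting speed. It is a known result that for every $\vec{p}\in(0,1)^M$ there is a deterministic constant $v(\vec{p})$ such that $\lim_{n\to\infty}X_n/n=v(\vec{p})$, $P_{\vec{p}}$-almost surely; $v(\vec{p})$ denotes this constant. Partial ordering. For $\vec{p},\vec{q}\in(0,1)^M$ we write $\vec{p}\preccurlyeq\vec{q}$ if there exists a coupling $\mathbf{P}$ of random vectors $\mathbf{Y}=(Y_1,\ldots,Y_M)$ and $\mathbf{Z}=(Z_1,\ldots,Z_M)$ such that: (i) $Y_1,\ldots,Y_M$ are independent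 Bernoulli random variables with $Y_j\sim\mathrm{Ber}(p_j)$; (ii) $Z_1,\ldots,Z_M$ are independent Bernoulli random variables with $Z_j\sim\mathrm{Ber}(q_j)$; (iii) $\mathbf{P}\left(\sum_{j=1}^m Y_j\le\sum_{j=1}^m Z_j\right)=1$ for every $m=1,\ldots,M$. (No independence between $\mathbf{Y}$ and $\mathbf{Z}$ is required.) We write $\vec{p}\prec\vec{q}$ if there is such a coupling for which, moreover, $\mathbf{P}\left(\sum_{j=1}^m Y_j<\sum_{j=1}^m Z_j\right)>0$ for some $m\le M$. *)

(* Defs.v *)
From HB Require Import structures.
From mathcomp Require Export all_boot all_order all_algebra.
From mathcomp Require Export all_classical all_reals all_analysis.

Set Implicit Arguments.
Unset Strict Implicit.
Unset Printing Implicit Defensive.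

Import Order.TTheory GRing.Theory Num.Theory.
Import numFieldNormedType.Exports.

Local Open Scope classical_set_scope.
Local Open Scope ring_scope.

(* The vector (p_1, ..., p_M) is a function p on 'I_M, with p_j = p (j - 1). *)
Definition cookie_env (R : realType) (M : nat) (p : 'I_M -> R) : Prop :=
  forall j, 0 < p j < 1.

(* Strength of the cookie used at the j-th visit (j >= 1) to a site. *)
Definition cookie (R : realType) (M : nat) (p : 'I_M -> R) (j : nat) : R :=
  if insub j.-1 is Some i then p i else 2^-1.

(* #{k <= n : X_k = X_n} *)
Definition visits (T : Type) (X : nat -> T -> int) (n : nat) (w : T) : nat :=
  #|[pred k : 'I_n.+1 | X k w == X n w]|.

(* sigma(X_k, k <= n), where int carries the discrete sigma-algebra. *)
Definition natural_filtration (T : Type) (X : nat -> T -> int) (n : nat) :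
    set (set T) :=
  <<s [set A | exists k B, (k <= n)%N /\ A = X k @^-1` B] >>.

(* g is a version of the conditional probability P(B | F). *)
Definition is_cond_prob (R : realType) (d : measure_display)
    (T : measurableType d) (P : probability T R) (F : set (set T))
    (B : set T) (g : T -> R) : Prop :=
  (forall Y : set R, measurable Y -> F (g @^-1` Y)) /\
  (forall A, F A -> P (A `&` B) = (\int[P]_(w in A) (g w)%:E)%E).

Record excited_random_walk (R : realType) (M : nat) (p : 'I_M -> R)
    (d : measure_display) (T : measurableType d) (P : probability T R)
    (X : nat -> T -> int) : Prop := {
  erw_measurable : forall n (B : set int), measurable (X n @^-1` B) ;
  erw_start : P [set w | X 0%N w = 0] = 1%E ;
  erw_right : forall n,
    is_cond_prob P (natural_filtration X n) [set w | X n.+1 w = X n w + 1]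
      (fun w => cookie p (visits X n w)) ;
  erw_left : forall n,
    is_cond_prob P (natural_filtration X n) [set w | X n.+1 w = X n w - 1]
      (fun w => 1 - cookie p (visits X n w)) }.

(* The law of the walk is determined by p, so v is the almost sure limit of
   X_n / n for every realization of the walk. *)
Definition limiting_speed (R : realType) (M : nat) (p : 'I_M -> R) (v : R) :
    Prop :=
  forall (d : measure_display) (T : measurableType d) (P : probability T R)
    (X : nat -> T -> int),
  excited_random_walk p P X ->
  {ae P, forall w, (fun n : nat => (X n w)%:~R / n%:R : R) @ \oo --> v}.

(* Taking some of the B j to be setT yields the product rule for subfamilies. *)
Definition mutually_independent (R : realType) (M : nat)
    (d d' : measure_display) (T : measurableType d) (T' : measurableType d')
    (P : probability T R) (Y : 'I_M -> {RV P >-> T'}) : Prop :=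
  forall B : 'I_M -> set T', (forall j, measurable (B j)) ->
  P (\bigcap_(j in [set: 'I_M]) (Y j @^-1` B j)) =
  (\prod_(j < M) P (Y j @^-1` B j))%E.

Definition independent_bernoulli (R : realType) (M : nat) (p : 'I_M -> R)
    (d : measure_display) (T : measurableType d) (P : probability T R)
    (Y : 'I_M -> {RV P >-> bool}) : Prop :=
  mutually_independent Y /\
  (forall j, distribution P (Y j) =1 bernoulli_prob (p j)).

(* Y_1 + ... + Y_m *)
Definition partial_sum (M : nat) (T : Type) (Y : 'I_M -> T -> bool) (m : nat)
    (w : T) : nat :=
  (\sum_(j < M | j < m) Y j w)%N.

Definition env_coupling (R : realType) (M : nat) (p q : 'I_M -> R)
    (d : measure_display) (T : measurableType d) (P : probability T R)
    (Y Z : 'I_M -> {RV P >-> bool}) : Prop :=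
  [/\ independent_bernoulli p Y,
      independent_bernoulli q Z &
      forall m, (1 <= m <= M)%N ->
        P [set w | (partial_sum Y m w <= partial_sum Z m w)%N] = 1%E].

Definition env_lt (R : realType) (M : nat) (p q : 'I_M -> R) : Prop :=
  exists (d : measure_display) (T : measurableType d) (P : probability T R)
    (Y Z : 'I_M -> {RV P >-> bool}),
  env_coupling p q Y Z /\
  exists m, (1 <= m <= M)%N /\
    (0 < P [set w | (partial_sum Y m w < partial_sum Z m w)%N])%E.

(* Main.v *)
Require Import Defs.
From mathcomp Require Import measurable_realfun zify lra ring.

Set Implicit Arguments.
Unset Strict Implicit.
Unset Printing Implicit Defensive.

Import Order.TTheory GRing.Theory Num.Theory.
Import numFieldNormedType.Exports.
Local Open Scope ring_scope.

(** The walk can be run on a field of arrows: every site carries its own stack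
of independent arrows, the [j]-th of which points right with probability the
strength of the [j]-th cookie, and at its [j]-th visit to a site the walk
follows the [j]-th arrow of that site. The relation between [p] and [q] then
says that two such fields can be coupled, site by site independently, so that
for every [m] the first [m] arrows of an upper stack contain at least as many
right arrows as those of the lower stack, and sometimes strictly more.

Reflecting space turns a pair of negative speeds into a pair of positive ones
and exchanges the roles of [p] and [q], so everything reduces to showing that
[0 < vp] implies [vp < vq] ([speed_lt]). Look at the time [a] when the lower
walk first hits a level [N]. Edge by edge, the number of right steps from [y]
exceeds that of left steps from [y + 1] by a known amount
([flow_balance]); hence the left steps from the sites [N], [N - 1], ... form a
chain, each one being the number of left arrows met in the stack at [y] before a
number of right arrows prescribed by the left steps from [y + 1]
([left_chainE]). Both dependences are monotone, so that until it hits [N] the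
upper walk departs from no site more often than the lower walk did
([dep_comparison]), and it departs less often from every site where the upper
stack is strictly ahead of the lower one at the right place
([dep_strict_comparison]). Summing over the sites, the upper walk hits [N]
earlier, by at least the number of such gaining sites
([upper_walk_hits_earlier]).

Gaining sites have a positive density. Since the lower walk reaches [N] within
a time of order [N], Markov's inequality shows that the chain stays below a
constant [K] at most sites ([many_small_left_counts]). Given that the chain is at
most [K] at [y + 2], the independent stacks at [y + 1] and [y] make the chain take
the critical value at [y + 1] and the site [y] gaining with a probability bounded
below ([expectation_gaining]). So with probability bounded below the upper walk
hits [N] at least [g * N] steps before the lower walk, for a constant [g], and this
contradicts [vq <= vp] ([speed_gap]).

The argument concerns finitely many steps only. Almost sure convergence of
[X n / n] is used through [speed_in_probability], which speaks of the weights of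
finite paths; to extract it, the walk is realized on the unit interval, where
the set of points with given first directions is an interval as long as the
weight of the path ([directions_itv]), and the random fields become finite
products of weights on finite sets, whose independence is expressed by resampling
one coordinate ([expectation_update]). *)

(** * Nearest-neighbour walks driven by a field of arrows *)

(** The second component counts the departures from each site, so that the walk
at [st.1] is about to use the arrow of index [st.2 st.1]. *)
Definition walk_state := (int * (int -> nat))%type.

Definition origin : walk_state := (0, fun=> 0%N).

Definition move (st : walk_state) (d : bool) : walk_state :=
  (if d then st.1 + 1 else st.1 - 1, fun y => (st.2 y + (y == st.1))%N).

Definition arrow_at (A : int -> nat -> bool) (st : walk_state) : bool :=
  A st.1 (st.2 st.1).

Definition walk (A : int -> nat -> bool) (n : nat) : walk_state :=
  iter n (fun st => move st (arrow_at A st)) origin.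

Definition rights (a : nat -> bool) (m : nat) : nat := (\sum_(j < m) a j)%N.

Definition lefts (a : nat -> bool) (m : nat) : nat := (\sum_(j < m) ~~ a j)%N.

Lemma rightsS a m : rights a m.+1 = (rights a m + a m)%N.
Proof. by rewrite /rights big_ord_recr. Qed.

Lemma leftsS a m : lefts a m.+1 = (lefts a m + ~~ a m)%N.
Proof. by rewrite /lefts big_ord_recr. Qed.

Lemma rights0 a : rights a 0 = 0%N. Proof. by rewrite /rights big_ord0. Qed.

Lemma lefts0 a : lefts a 0 = 0%N. Proof. by rewrite /lefts big_ord0. Qed.

Lemma rights_lefts a m : (rights a m + lefts a m = m)%N.
Proof.
elim: m => [|m IH]; first by rewrite rights0 lefts0.
by rewrite rightsS leftsS; case: (a m); lia.
Qed.

Lemma leq_rights a m n : (m <= n)%N -> (rights a m <= rights a n)%N.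
Proof.
elim: n => [|n IH]; first by rewrite leqn0 => /eqP ->.
rewrite leq_eqVlt => /orP[/eqP -> //|/IH]; rewrite rightsS; lia.
Qed.

Lemma leq_lefts a m n : (m <= n)%N -> (lefts a m <= lefts a n)%N.
Proof.
elim: n => [|n IH]; first by rewrite leqn0 => /eqP ->.
rewrite leq_eqVlt => /orP[/eqP -> //|/IH]; rewrite leftsS; lia.
Qed.

Section Walk.
Variable A : int -> nat -> bool.
Implicit Types (n : nat) (y : int).

Local Notation pos n := (walk A n).1.
Local Notation dep n := (walk A n).2.

Lemma posS n : pos n.+1 = if A (pos n) (dep n (pos n)) then pos n + 1 else pos n - 1.
Proof. by []. Qed.

Lemma depS n y : dep n.+1 y = (dep n y + (y == pos n))%N.
Proof. by []. Qed.

(** The two sides differ by the crossings of the edge between [y] and [y + 1],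
counted with sign, and these are determined by the sides of the edge on which
the walk starts and stands. *)
Lemma flow_balance n y :
  (rights (A y) (dep n y) + (pos n <= y)%R =
   lefts (A (y + 1)%R) (dep n (y + 1)%R) + (0 <= y)%R)%N.
Proof.
elim: n => [|n IH]; first by rewrite /= rights0 lefts0.
rewrite posS !depS.
set x := pos n in IH *.
have [yx|yx] := eqVneq y x.
  have -> : (y + 1 == x) = false by apply/negbTE; lia.
  move: IH; rewrite addn1 addn0 rightsS yx.
  by case: (A x (dep n x)); lia.
have [y1x|y1x] := eqVneq (y + 1) x.
  move: IH; rewrite addn1 addn0 leftsS y1x.
  by case: (A x (dep n x)); lia.
rewrite !addn0; case: (A x (dep n x)); lia.
Qed.

(** After a left step from [y] the walk would have to pass through [y] again
before standing to its right. *)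
Lemma last_departure_right n y :
  y < pos n -> (0 < dep n y)%N -> A y (dep n y).-1.
Proof.
elim: n => [//|n IH]; rewrite posS !depS.
have [->|yx] := eqVneq y (pos n).
  by rewrite addn1 /=; case: (A _ _) => //; lia.
rewrite addn0; move=> yp; apply: IH; move: yp.
by case: (A _ _); lia.
Qed.

Lemma pos_le n : `|pos n| <= n%:Z.
Proof.
elim: n => [//|n IH]; rewrite posS; case: (A _ _); lia.
Qed.

(** Each step departs from exactly one site, so summing over sites recovers the
time. This is how comparisons of departures become comparisons of times. *)
Lemma sum_dep n (r : seq int) : uniq r ->
  (\sum_(y <- r) dep n y = \sum_(k < n) (pos k \in r))%N.
Proof.
move=> ur; elim: n => [|n IH]; first by rewrite big_ord0 big1.
rewrite big_ord_recr /= -IH.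
under eq_bigr do rewrite /=.
rewrite big_split /=; congr addn.
by rewrite -big_mkcond /= sum1_count -(count_uniq_mem _ ur).
Qed.

Lemma sum_dep_le n (r : seq int) : uniq r -> (\sum_(y <- r) dep n y <= n)%N.
Proof.
move=> ur; rewrite sum_dep //; apply: (@leq_trans (\sum_(k < n) 1)).
  by apply: leq_sum => k _; case: (_ \in _).
by rewrite sum1_card card_ord.
Qed.

Lemma sum_dep_all n (r : seq int) : uniq r ->
  (forall k, (k < n)%N -> pos k \in r) -> (\sum_(y <- r) dep n y = n)%N.
Proof.
move=> ur rP; rewrite sum_dep //.
under eq_bigr => k _ do rewrite rP //.
by rewrite sum1_card card_ord.
Qed.

Lemma dep_le n y : (dep n y <= n)%N.
Proof. by have := @sum_dep_le n [:: y] isT; rewrite big_seq1. Qed.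

Lemma dep_eq0 n y : (forall k, (k < n)%N -> pos k != y) -> dep n y = 0%N.
Proof.
move=> h; have := @sum_dep n [:: y] isT; rewrite big_seq1 => ->.
by rewrite big1 // => k _; rewrite inE (negbTE (h _ _)).
Qed.

Lemma first_hit n (x : int) : 0 < x -> x <= pos n ->
  exists m, [/\ (m <= n)%N, pos m = x & forall k, (k < m)%N -> pos k < x].
Proof.
move=> x0 xn.
have ex : exists m, x <= pos m by exists n.
case: (ex_minnP ex) => m xm min.
have mlt k : (k < m)%N -> pos k < x.
  by move=> km; rewrite ltNge; apply/negP => /min; rewrite leqNgt km.
exists m; split => //; first exact: min.
case: m xm min mlt => [|m] xm min mlt; first by move: xm x0 => /=; lia.
by have := mlt m (ltnSn m); move: xm; rewrite posS; case: (A _ _); lia.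
Qed.

End Walk.

(** * Comparison of two walks at the hitting time of a level *)

Definition stack_le (a b : nat -> bool) : Prop :=
  forall m, (rights a m <= rights b m)%N.

(** The hypothesis forces [g < f]: for [f <= g] the stack [b] would have shown as
many right arrows as [a] already. *)
Lemma lefts_le_of_rights_lt a b f g :
  stack_le a b -> (rights b g < rights a f)%N -> (lefts b g <= lefts a f)%N.
Proof.
move=> ab gf; have [fg|gf'] := leqP f g.
  by have := leq_rights b fg; have := ab f; lia.
have := leq_lefts a (ltnW gf'); have := ab g.
by have := rights_lefts a g; have := rights_lefts b g; lia.
Qed.

(** Having used one right arrow more than the first [m] arrows of [a] contain, the
first walk is past the index [m] and has met all the left arrows before it. The
second walk has not yet used all the right arrows among the first [m] of [b], of
which there are more, so it has met at most the left arrows before [m], of which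
there are fewer. *)
Lemma lefts_lt_of_overtaking a b f g m :
  (rights a m < rights b m)%N -> rights a f = (rights a m).+1 ->
  (rights b g <= rights a m)%N -> (lefts b g < lefts a f)%N.
Proof.
move=> abm fE gm.
have mf : (m <= f)%N.
  by rewrite leqNgt; apply/negP => /ltnW /(leq_rights a); lia.
have gm' : (g <= m)%N.
  by rewrite leqNgt; apply/negP => /ltnW /(leq_rights b); lia.
have := leq_lefts a mf; have := leq_lefts b gm'.
by have := rights_lefts a m; have := rights_lefts b m; lia.
Qed.

(** The left arrows met before the [k]-th right arrow. Cutting the stack at the
time horizon [h] makes the sum finite and changes nothing for a walk of at most
[h] steps. *)
Definition lefts_before (h : nat) (a : nat -> bool) (k : nat) : nat :=
  (\sum_(j < h) (~~ a j && (rights a j < k)))%N.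

Lemma lefts_beforeE h (a : nat -> bool) f : (0 < f <= h)%N -> a f.-1 ->
  lefts_before h a (rights a f) = lefts a f.
Proof.
case: f => [//|f] /= fh af; rewrite /lefts_before /lefts.
rewrite (big_ord_widen _ (fun j => ~~ a j : nat) fh) [RHS]big_mkcond /=.
apply: eq_bigr => j _; have [jf|fj] := ltnP j f.+1.
  have := leq_rights a (_ : j <= f)%N; rewrite rightsS af => /(_ jf) rj.
  by rewrite (_ : (_ < _)%N) ?andbT // addn1 ltnS.
by rewrite ltnNge (leq_rights a fj) andbF.
Qed.

(** The value at [k] belongs to the site [N - k]. As a process in [k] this is the
branching process with migration which encodes an excited random walk: each
left step from [y + 1] causes one more right step from [y], and the walk that
starts at [0] and stops at [N] adds one. *)
Fixpoint left_chain (h : nat) (A : int -> nat -> bool) (N k : nat) : nat :=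
  if k is k'.+1 then
    lefts_before h (A (N%:Z - k%:Z)) (left_chain h A N k').+1
  else 0%N.

(** Let [y] be the site [N - k - 1]. When the walk first hits [N] it stands to the
right of [y], so its last arrow at [y] is a right arrow and its left steps from
[y] are exactly the left arrows which precede it. By [flow_balance] that arrow is
the right arrow number [left_chain h A N k + 1]. *)
Lemma left_chainE h A (N a : nat) :
  (walk A a).1 = N%:Z -> (forall k, (k < a)%N -> (walk A k).1 < N%:Z) ->
  (a <= h)%N -> forall k, (k <= N)%N ->
  lefts (A (N%:Z - k%:Z)) ((walk A a).2 (N%:Z - k%:Z)) = left_chain h A N k.
Proof.
move=> aN fst ah; elim=> [_|k IH kN].
  rewrite subr0 dep_eq0 ?lefts0 // => k /fst; lia.
have {}IH := IH (ltnW kN); rewrite /left_chain -/left_chain.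
set y := N%:Z - k.+1%:Z; have y1 : y + 1 = N%:Z - k%:Z by rewrite /y; lia.
have := flow_balance A a y; rewrite y1 IH aN.
have -> : (N%:Z <= y) = false by rewrite /y; lia.
have -> : (0 <= y) by rewrite /y; lia.
rewrite addn0 addn1 => <-; rewrite lefts_beforeE //.
  rewrite (leq_trans (dep_le _ _ _) ah) andbT lt0n; apply/eqP => f0.
  have := flow_balance A a y; rewrite y1 IH aN f0 rights0.
  by rewrite /y; lia.
apply: (@last_departure_right A a y); first by rewrite aN /y; lia.
rewrite lt0n; apply/eqP => f0.
by have := flow_balance A a y; rewrite y1 IH aN f0 rights0 /y; lia.
Qed.

Section Comparison.
Variables (A B : int -> nat -> bool) (N : int) (a b : nat).
Hypothesis AB : forall y, stack_le (A y) (B y).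
Hypothesis aN : (walk A a).1 = N.
Hypothesis bN : forall k, (k < b)%N -> (walk B k).1 < N.

Local Notation f := (walk A a).2.
Local Notation g := (walk B b).2.

(** The second conclusion removes the last arrow at [y] when the upper walk stands
to the right of [y]: this is a right arrow, so the left steps are unchanged while
the right ones become strictly fewer than those of the lower walk. When the
upper walk stands at or to the left of [y] they are strictly fewer already. *)
Lemma site_comparison y : y < N ->
  (lefts (B (y + 1)%R) (g (y + 1)%R) <= lefts (A (y + 1)%R) (f (y + 1)%R))%N ->
  (rights (B y) (g y) <= rights (A y) (f y))%N /\
  (g y = 0%N \/ exists2 m, (rights (B y) m < rights (A y) (f y))%N &
                          lefts (B y) m = lefts (B y) (g y)).
Proof.
move=> yN lef.
have := flow_balance A a y; have := flow_balance B b y; rewrite aN.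
have -> : (N <= y) = false by lia.
move=> fB fA; split; first by lia.
have [-> |g0] := posnP (g y); [by left|right].
case: (lerP (walk B b).1 y) fB => [Xy fB|yX fB]; first by exists (g y) => //; lia.
have last := last_departure_right yX g0.
exists (g y).-1; case: (g y) g0 last fB => [//|m] _ /= last;
  by rewrite ?rightsS ?leftsS last ?addn0 //; lia.
Qed.

(** Induction on the distance to [N], beyond which the upper walk has never been. *)
Lemma lefts_comparison y :
  (lefts (B y) (g y) <= lefts (A y) (f y))%N.
Proof.
have high z : N <= z -> (lefts (B z) (g z) <= lefts (A z) (f z))%N.
  by move=> Nz; rewrite [g z]dep_eq0 ?lefts0 // => k /bN; lia.
have [|yN] := lerP N y; first exact: high.
have [n yE] : exists n : nat, y = N - n%:Z by exists `|N - y|%N; lia.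
rewrite {yN}yE; elim: n => [|n IH]; first by apply: high; lia.
have [] := @site_comparison (N - n.+1%:Z).
- by lia.
- by have -> : N - n.+1%:Z + 1 = N - n%:Z by lia.
move=> _ [-> |[m rm <-]]; first by rewrite lefts0.
exact: lefts_le_of_rights_lt (AB _) rm.
Qed.

Lemma dep_comparison y : (g y <= f y)%N.
Proof.
have [Ny|yN] := lerP N y; first by rewrite [g y]dep_eq0 // => k /bN; lia.
have [+ _] := site_comparison yN (lefts_comparison _).
have := lefts_comparison y.
by have := rights_lefts (A y) (f y); have := rights_lefts (B y) (g y); lia.
Qed.

Lemma dep_strict_comparison y m : 0 <= y < N ->
  (rights (A y) m < rights (B y) m)%N ->
  lefts (A (y + 1)) (f (y + 1)) = rights (A y) m ->
  (g y < f y)%N.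
Proof.
move=> /andP[y0 yN] abm lm.
have := flow_balance A a y; rewrite lm aN y0.
have -> : (N <= y) = false by lia.
rewrite addn0 addn1 => fE.
have [rle g0] := site_comparison yN (lefts_comparison _).
suff : (lefts (B y) (g y) < lefts (A y) (f y))%N.
  by have := rights_lefts (A y) (f y); have := rights_lefts (B y) (g y); lia.
case: g0 => [g0|[m' rm <-]]; apply: (lefts_lt_of_overtaking abm fE).
  by rewrite g0 rights0.
by rewrite -ltnS -fE.
Qed.

End Comparison.

(** The times [a] and [b] are the total numbers of departures, compared site by
site. *)
Lemma hitting_time_gain (A B : int -> nat -> bool) (N h a b m s : nat)
    (ks : seq nat) :
  (forall y, stack_le (A y) (B y)) ->
  (walk A a).1 = N%:Z -> (forall k, (k < a)%N -> (walk A k).1 < N%:Z) ->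
  (a <= h)%N ->
  (forall k, (k < b)%N -> (walk B k).1 < N%:Z) ->
  uniq ks ->
  (forall k, k \in ks ->
     [/\ (k.+1 < N)%N, left_chain h A N k.+1 = s,
         rights (A (N%:Z - k.+2%:Z)%R) m = s &
         (s < rights (B (N%:Z - k.+2%:Z)%R) m)%N]) ->
  (b + size ks <= a)%N.
Proof.
move=> AB aN fst ah bN uks ksP.
pose site (k : nat) := N%:Z - k.+2%:Z.
pose r := undup ([seq (walk B k).1 | k <- iota 0 b] ++ map site ks).
have ur : uniq r by exact: undup_uniq.
have us : uniq (map site ks).
  by rewrite map_inj_uniq // => k k'; rewrite /site; lia.
have gainE : (\sum_(y <- r) (y \in map site ks) = size ks)%N.
  rewrite -(size_map site) -big_mkcond /= sum1_count -size_filter.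
  apply/perm_size/uniq_perm => [|//|y]; first exact: filter_uniq.
  rewrite mem_filter /r mem_undup mem_cat.
  by case: (y \in map site ks); rewrite ?orbT.
have bE : (\sum_(y <- r) (walk B b).2 y = b)%N.
  apply: sum_dep_all => // k kb; rewrite /r mem_undup mem_cat.
  by apply/orP; left; apply/mapP; exists k; rewrite // mem_iota.
rewrite -{1}bE -gainE -big_split /=.
apply: leq_trans (sum_dep_le A a ur); apply: leq_sum => y _.
have [/mapP[k /ksP[kN ck Am Bm] ->]|_] := boolP (y \in _); last first.
  by rewrite addn0; exact: dep_comparison AB aN bN y.
rewrite addn1; apply: (dep_strict_comparison AB aN bN (m := m)).
- by rewrite /site; lia.
- by rewrite Am.
rewrite Am -ck -(left_chainE aN fst ah) ?(ltnW kN) //.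
by have -> : site k + 1 = N%:Z - k.+1%:Z by rewrite /site; lia.
Qed.

Lemma upper_walk_hits_earlier (A B : int -> nat -> bool) (N h a m s : nat)
    (ks : seq nat) :
  (forall y, stack_le (A y) (B y)) ->
  (walk A a).1 = N%:Z -> (forall k, (k < a)%N -> (walk A k).1 < N%:Z) ->
  (a <= h)%N ->
  uniq ks ->
  (forall k, k \in ks ->
     [/\ (k.+1 < N)%N, left_chain h A N k.+1 = s,
         rights (A (N%:Z - k.+2%:Z)%R) m = s &
         (s < rights (B (N%:Z - k.+2%:Z)%R) m)%N]) ->
  exists2 k, (k + size ks <= a)%N & N%:Z <= (walk B k).1.
Proof.
move=> AB aN fst ah uks ksP.
have gain b : (forall k, (k < b)%N -> (walk B k).1 < N%:Z) ->
    (b + size ks <= a)%N.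
  by move=> bN; exact: hitting_time_gain AB aN fst ah bN uks ksP.
have ks_a : (size ks <= a)%N by have := gain 0%N; rewrite add0n; apply.
apply: contrapT => none; have : ((a - size ks).+1 + size ks <= a)%N.
  apply: gain => k kb; rewrite ltNge; apply/negP => Nk; apply: none.
  by exists k => //; rewrite addnC -leq_subRL.
by rewrite addSn subnK // ltnn.
Qed.

(** * The law of the first steps of the walk *)

Lemma move_norm st d (k t : nat) :
  `|st.1| + k.+1%:Z <= t%:Z -> `|(move st d).1| + k%:Z <= t%:Z.
Proof. by case: st => x f /=; case: d; lia. Qed.

Lemma norm_of_room (st : walk_state) (k t : nat) :
  `|st.1| + k%:Z <= t%:Z -> `|st.1| <= t%:Z.
Proof. by case: st => x f /=; lia. Qed.

Definition trail (ds : seq bool) : walk_state := foldl move origin ds.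

Fixpoint steps (A : int -> nat -> bool) (st : walk_state) (n : nat) : seq bool :=
  if n is n'.+1 then
    arrow_at A st :: steps A (move st (arrow_at A st)) n'
  else [::].

Lemma size_steps A st n : size (steps A st n) = n.
Proof. by elim: n st => //= n IH st; rewrite IH. Qed.

Lemma trail_steps A n m : (m <= n)%N ->
  trail (take m (steps A origin n)) = walk A m.
Proof.
pose next st := move st (arrow_at A st).
rewrite /trail /walk -/next; elim: n m origin => [|n IH] [|m] st //= mn.
by rewrite IH //; exact: (esym (iterSr m next st)).
Qed.

Lemma eq_steps A A' (t n : nat) st m :
  `|st.1| + m%:Z <= t%:Z -> (forall y, (st.2 y + m <= n)%N) ->
  (forall y j, `|y| <= t%:Z -> (st.2 y <= j < n)%N -> A y j = A' y j) ->
  steps A st m = steps A' st m.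
Proof.
elim: m st => [//|m IH] [x f] /= st1 st2 AA'.
have -> : arrow_at A (x, f) = arrow_at A' (x, f).
  apply: AA' => /=; first by lia.
  by move: (st2 x); rewrite leqnn /=; lia.
congr cons; apply: IH => [|y|y j yt] /=.
- by case: (arrow_at _ _); lia.
- by have := st2 y; case: (y == _); lia.
- by move=> jn; apply: AA' => //; lia.
Qed.

Definition bernoulli_weight (R : realType) (c : R) (d : bool) : R :=
  if d then c else 1 - c.

Fixpoint path_weight (R : realType) (M : nat) (p : 'I_M -> R)
    (st : walk_state) (ds : seq bool) : R :=
  if ds is d :: ds' then
    bernoulli_weight (cookie p (st.2 st.1).+1) d * path_weight p (move st d) ds'
  else 1.

Section ProductWeight.
Variables (R : realType) (I S : finType) (w : I -> S -> R).

Definition product_weight (o : {ffun I -> S}) : R := \prod_i w i (o i).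

Definition expectation (F : {ffun I -> S} -> R) : R :=
  \sum_o product_weight o * F o.

Definition update (o : {ffun I -> S}) (i : I) (s : S) : {ffun I -> S} :=
  [ffun k => if k == i then s else o k].

Lemma updateE o i s : update o i s i = s.
Proof. by rewrite ffunE eqxx. Qed.

Lemma update_neq o i s k : k != i -> update o i s k = o k.
Proof. by rewrite ffunE => /negbTE ->. Qed.

(** Resampling the coordinate [i] preserves the product weight, because exchanging
[o i] with an independent copy [s] is an involution which preserves the weight of
the pair [(o, s)]. Independence is always used in this form: where [F] depends on
the coordinate [i] through one factor only, the inner sum evaluates that factor. *)
Lemma expectation_update i (F : {ffun I -> S} -> R) : \sum_s w i s = 1 ->
  expectation F = expectation (fun o => \sum_s w i s * F (update o i s)).
Proof.
move=> w1; rewrite /expectation.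
under [RHS]eq_bigr do rewrite mulr_sumr.
under [LHS]eq_bigr do rewrite -[_ * _]mul1r -w1 mulr_suml.
rewrite !pair_big /=.
(* The exchange of [o i] with the fresh value. *)
pose swap (u : {ffun I -> S} * S) := (update u.1 i u.2, u.1 i).
have swapK : involutive swap.
  case=> o s; rewrite /swap /= updateE; congr pair.
  by apply/ffunP => k; rewrite !ffunE; case: eqP => [->|].
rewrite (reindex_inj (inv_inj swapK)) /=.
apply: eq_bigr; case=> o s _ /=; rewrite !mulrA; congr (_ * _).
rewrite /product_weight (bigD1 i) //= [in RHS](bigD1 i) //= updateE mulrCA.
rewrite mulrAC mulrA; congr (_ * _); first by rewrite mulrC.
by apply: eq_bigr => k ki; rewrite update_neq.
Qed.

Lemma expectation_le (F G : {ffun I -> S} -> R) :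
  (forall i s, 0 <= w i s) ->
  (forall o : {ffun I -> S}, (forall i, 0 < w i (o i)) -> F o <= G o) ->
  expectation F <= expectation G.
Proof.
move=> w0 FG; apply: ler_sum => o _.
have [/forallP h|/forallPn[i]] := boolP [forall i, 0 < w i (o i)].
  by apply: ler_wpM2l; [exact: prodr_ge0 | exact: FG].
rewrite lt0r w0 andbT negbK => /eqP wi0.
by rewrite /product_weight (bigD1 i) //= wi0 !mul0r.
Qed.

Lemma expectationD (F G : {ffun I -> S} -> R) :
  expectation (fun o => F o + G o) = expectation F + expectation G.
Proof. by rewrite -big_split; apply: eq_bigr => o _; rewrite mulrDr. Qed.

Lemma expectationZ c (F : {ffun I -> S} -> R) :
  expectation (fun o => c * F o) = c * expectation F.
Proof. by rewrite mulr_sumr; apply: eq_bigr => o _; rewrite mulrCA. Qed.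

Lemma expectation_sum n (F : 'I_n -> {ffun I -> S} -> R) :
  expectation (fun o => \sum_k F k o) = \sum_k expectation (F k).
Proof. by rewrite exchange_big; apply: eq_bigr => o _; rewrite mulr_sumr. Qed.

Lemma product_weight_total : (forall i, \sum_s w i s = 1) ->
  \sum_o product_weight o = 1.
Proof.
move=> w1; rewrite /product_weight -(bigA_distr_bigA (fun i s => w i s)).
by apply: big1 => i _; exact: w1.
Qed.

Lemma expectation_cst c : (forall i, \sum_s w i s = 1) ->
  expectation (fun=> c) = c.
Proof. by move=> w1; rewrite /expectation -mulr_suml product_weight_total ?mul1r. Qed.

End ProductWeight.

Section PathLaw.
Variables (R : realType) (M : nat) (p : 'I_M -> R).

Let coin n (I : finType) (ij : I * 'I_n) (d : bool) : R :=
  bernoulli_weight (cookie p (ij.2 : nat).+1) d.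

Lemma bernoulli_weight_sum (c : R) : \sum_d bernoulli_weight c d = 1.
Proof. by rewrite big_bool /= addrC subrK. Qed.

Let arrows (I : finType) n (site : int -> I) (b : {ffun I * 'I_n -> bool})
    (y : int) (j : nat) : bool :=
  if insub j is Some j' then b (site y, j') else false.

(** The first step reads the arrow of index [st.2 x] at [x := st.1], and no later
step reads that arrow again: resampling it splits off the first factor of the
path weight. The bounds keep the walk within the finitely many sites which
[site] separates and the finitely many arrows present there. *)
Lemma independent_arrows_law (I : finType) (n t : nat) (site : int -> I) :
  {in [pred y : int | `|y| <= t%:Z] &, injective site} ->
  forall (ds : seq bool) (st : walk_state),
  `|st.1| + (size ds)%:Z <= t%:Z -> (forall y, (st.2 y + size ds <= n)%N) ->
  expectation (@coin n I)
    (fun b => (steps (arrows site b) st (size ds) == ds)%:R) =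
  path_weight p st ds.
Proof.
move=> site_inj; elim=> [|d ds IH] st st1 st2 /=.
  rewrite /expectation; under eq_bigr do rewrite (mulr1 _).
  by apply: product_weight_total => ij; exact: bernoulli_weight_sum.
set x := st.1; have jn : (st.2 x < n)%N by have := st2 x; rewrite /=; lia.
pose i0 := (site x, Ordinal jn).
rewrite (expectation_update (i := i0)); last exact: bernoulli_weight_sum.
rewrite -(IH (move st d)); first last.
- by move=> y; have := st2 y; rewrite /=; case: (y == _); lia.
- exact: move_norm st1.
rewrite /expectation mulr_sumr; apply: eq_bigr => b _.
rewrite mulrCA; congr (_ * _).
rewrite (bigD1 d) //= big1 ?addr0; last first.
  move=> e ed; rewrite eqseq_cons {1}/arrow_at /arrows -/x.
  by rewrite insubT updateE (negbTE ed) mulr0.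
rewrite /coin /=; congr (_ * _); rewrite eqseq_cons.
have -> : arrow_at (arrows site (update b i0 d)) st = d.
  by rewrite /arrow_at /arrows -/x insubT updateE.
rewrite eqxx /=; congr ((_ == _)%:R).
apply: (@eq_steps _ _ t n).
- exact: move_norm st1.
- by move=> y; have := st2 y; rewrite /=; case: (y == _); lia.
move=> y j yt /= /andP[yj jn']; rewrite /arrows insubT update_neq //.
apply/eqP => -[/site_inj]; rewrite !inE => /(_ yt) yx jE.
move: yj; rewrite yx -/x ?eqxx ?jE; first by lia.
exact: norm_of_room st1.
Qed.

(** The hypothesis on [w] only concerns the arrows which [arr] reads off the stack
of one site. Since the steps of the walk are a function of these arrows, the law
of the whole field may be replaced by that of independent arrows. *)
Lemma path_law (I S : finType) (w : S -> R) (arr : S -> nat -> bool)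
    (n t : nat) (site : int -> I) (G : seq bool -> R) :
  {in [pred y : int | `|y| <= t%:Z] &, injective site} -> (t <= n)%N ->
  (forall al : {ffun 'I_n -> bool},
    \sum_(s | [forall j : 'I_n, arr s j == al j]) w s =
    \prod_(j < n) bernoulli_weight (cookie p j.+1) (al j)) ->
  expectation (fun _ : I => w)
    (fun o => G (steps (fun y => arr (o (site y))) origin t)) =
  \sum_(ds : t.-tuple bool) path_weight p origin ds * G ds.
Proof.
move=> site_inj tn law.
pose field (o : {ffun I -> S}) : {ffun I * 'I_n -> bool} :=
  [ffun ij : I * 'I_n => arr (o ij.1) (ij.2 : nat)].
have fieldE (o : {ffun I -> S}) : steps (fun y => arr (o (site y))) origin t =
    steps (arrows site (field o)) origin t.
  apply: (@eq_steps _ _ t n) => // y j _ /andP[_ jn].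
  by rewrite /arrows insubT ffunE.
(* Fibre the product over the stacks along the arrows that they show. *)
have marginal (F : {ffun I * 'I_n -> bool} -> R) :
    expectation (fun _ : I => w) (fun o => F (field o)) =
    expectation (@coin n I) F.
  rewrite /expectation (partition_big field xpredT) //=; apply: eq_bigr => b _.
  under eq_bigr => o /eqP fo do rewrite fo.
  rewrite -mulr_suml; congr (_ * _).
  pose ok i s := [forall j : 'I_n, arr s j == b (i, j)].
  rewrite big_mkcond /=.
  under eq_bigr => o _.
    have -> : (if field o == b then product_weight (fun _ : I => w) o else 0) =
        \prod_i (if ok i (o i) then w (o i) else 0).
      case: ifP => [/eqP fb|fb].
        apply: eq_bigr => i _; rewrite ifT //; apply/forallP => j.
        by rewrite -fb ffunE.
      have /existsP[i nok] : [exists i, ~~ ok i (o i)].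
        rewrite -negb_forall; apply/negP => /forallP h; move/negP: fb; apply.
        by apply/eqP/ffunP => -[i j]; rewrite ffunE; apply/eqP/(forallP (h i)).
      by rewrite (bigD1 i) //= (negbTE nok) mul0r.
    over.
  rewrite -(bigA_distr_bigA (fun i s => if ok i s then w s else 0)).
  transitivity (\prod_i \prod_(j < n) coin (i, j) (b (i, j))); last first.
    by rewrite pair_bigA; apply: eq_bigr => -[].
  apply: eq_bigr => i _; rewrite -big_mkcond /=.
  transitivity (\prod_(j < n)
      bernoulli_weight (cookie p j.+1) ([ffun j => b (i, j)] j)).
    rewrite -law; apply: eq_bigl => s; apply: eq_forallb => j.
    by rewrite ffunE.
  by apply: eq_bigr => j _; rewrite ffunE.
under [LHS]eq_bigr do rewrite fieldE.
rewrite -/(expectation _ _).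
rewrite (marginal (fun b => G (steps (arrows site b) origin t))).
rewrite /expectation.
pose tup (b : {ffun I * 'I_n -> bool}) := @Tuple t _ (steps (arrows site b) origin t)
  (introT eqP (size_steps _ _ _)).
rewrite (partition_big tup xpredT) //=; apply: eq_bigr => ds _.
rewrite -(@independent_arrows_law I n t site) // ?size_tuple ?add0r //.
rewrite /expectation mulr_suml big_mkcond /=; apply: eq_bigr => b _.
rewrite -val_eqE /=; case: eqP => [->|_]; first by rewrite mulr1.
by rewrite mulr0 mul0r.
Qed.

End PathLaw.

(** * Coupled stacks of arrows at one site *)

Definition heads (M : nat) (y : {ffun 'I_M -> bool}) (m : nat) : nat :=
  (\sum_(j < M | j < m) y j)%N.

Record cookie_coupling (R : realType) (M : nat) (p q : 'I_M -> R)
    (pi : {ffun 'I_M -> bool} -> {ffun 'I_M -> bool} -> R) : Prop := {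
  coupling_ge0 : forall y z, 0 <= pi y z ;
  coupling_fst : forall y, \sum_z pi y z = \prod_j bernoulli_weight (p j) (y j) ;
  coupling_snd : forall z, \sum_y pi y z = \prod_j bernoulli_weight (q j) (z j) ;
  coupling_le : forall y z m, 0 < pi y z -> (heads y m <= heads z m)%N ;
  coupling_lt : exists y z m, [/\ (m <= M)%N, 0 < pi y z & (heads y m < heads z m)%N] }.

(** The cookies of the lower and upper stacks, followed by [t] fair coins which
the two stacks share. *)
Definition site_stack (M t : nat) : finType :=
  ({ffun 'I_M -> bool} * {ffun 'I_M -> bool} * {ffun 'I_t -> bool})%type.

Definition cookies_then_coins (M t : nat) (y : {ffun 'I_M -> bool})
    (c : {ffun 'I_t -> bool}) (j : nat) : bool :=
  if insub j is Some i then y i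
  else if insub (j - M)%N is Some i then c i else false.

Definition lower_arrows M t (s : site_stack M t) := cookies_then_coins s.1.1 s.2.

Definition upper_arrows M t (s : site_stack M t) := cookies_then_coins s.1.2 s.2.

(** The second term does not depend on [y]: shared coins contribute equally to
both stacks, so only the cookies matter when two stacks are compared. *)
Lemma rights_cookies_then_coins M t (y : {ffun 'I_M -> bool})
    (c : {ffun 'I_t -> bool}) m :
  (rights (cookies_then_coins y c) m =
   heads y m + rights (fun j => (M <= j) && cookies_then_coins y c j) m)%N.
Proof.
have headsS n : heads y n.+1 =
    (heads y n + ((n < M) && cookies_then_coins y c n))%N.
  rewrite /heads /cookies_then_coins !(big_mkcond (fun j : 'I_M => j < _)%N).
  case: insubP => [i im iE|nM].
    rewrite (bigD1 i) //= [in RHS](bigD1 i) //= iE ltnSn ltnn add0n addnC im.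
    congr addn; apply: eq_bigr => j ji; rewrite ltnS leq_eqVlt.
    by rewrite -iE (_ : (j == i :> nat) = false) //; exact/negbTE.
  rewrite (negbTE nM) addn0; apply: eq_bigr => j _.
  by have := ltn_ord j; rewrite ltnS; case: (ltngtP j n) => // *; exfalso; lia.
elim: m => [|m IH]; first by rewrite !rights0 /heads big_pred0.
rewrite !rightsS headsS IH [in RHS]leqNgt.
by case: (m < M)%N => /=; lia.
Qed.

Lemma rights_cookies M t (y : {ffun 'I_M -> bool}) (c : {ffun 'I_t -> bool}) m :
  (m <= M)%N -> rights (cookies_then_coins y c) m = heads y m.
Proof.
move=> mM; rewrite rights_cookies_then_coins [X in (_ + X)%N]big1 ?addn0 // => j _.
by rewrite leqNgt (leq_trans (ltn_ord j) mM).
Qed.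

Lemma stack_le_of_coupling (R : realType) (M t : nat) (p q : 'I_M -> R) pi
    (s : site_stack M t) :
  cookie_coupling p q pi -> 0 < pi s.1.1 s.1.2 ->
  stack_le (lower_arrows s) (upper_arrows s).
Proof.
move=> pq s0 m; rewrite !rights_cookies_then_coins leq_add //.
  exact: (coupling_le pq).
apply: leq_sum => j _; rewrite /cookies_then_coins.
by case: insubP => [i im _|//]; rewrite (leqNgt M) im.
Qed.

Section StackLaw.
Variables (R : realType) (M t : nat) (p q : 'I_M -> R).
Variable pi : {ffun 'I_M -> bool} -> {ffun 'I_M -> bool} -> R.
Hypothesis pq : cookie_coupling p q pi.

Definition stack_weight (s : site_stack M t) : R := pi s.1.1 s.1.2 / 2 ^+ t.

Lemma stack_weight_ge0 s : 0 <= stack_weight s.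
Proof. by apply: divr_ge0; [exact: coupling_ge0 pq _ _|exact: exprn_ge0]. Qed.

Lemma cookies_then_coins_ord (y : {ffun 'I_M -> bool}) (c : {ffun 'I_t -> bool})
    (al : {ffun 'I_(M + t) -> bool}) :
  [forall j : 'I_(M + t), cookies_then_coins y c j == al j] =
  (y == [ffun i => al (lshift t i)]) && (c == [ffun i => al (rshift M i)]).
Proof.
have yE (i : 'I_M) : cookies_then_coins y c (lshift t i) = y i.
  rewrite /cookies_then_coins insubT //= => iM; congr (y _); exact: val_inj.
have cE (i : 'I_t) : cookies_then_coins y c (rshift M i) = c i.
  rewrite /cookies_then_coins insubF /=; last by rewrite ltnNge leq_addr.
  rewrite insubT /=; first by rewrite addKn.
  by move=> iM; congr (c _); apply: val_inj; rewrite /= addKn.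
apply/forallP/andP => [h|[/eqP y0 /eqP c0] j].
  split; apply/eqP/ffunP => i; rewrite ffunE; apply/eqP.
    by rewrite -(eqP (h (lshift t i))) yE.
  by rewrite -(eqP (h (rshift M i))) cE.
case: (splitP j) => i ji.
  by rewrite (_ : j = lshift t i) ?yE ?y0 ?ffunE //; exact: val_inj.
by rewrite (_ : j = rshift M i) ?cE ?c0 ?ffunE //; exact: val_inj.
Qed.

Lemma cookie_lshift (r : 'I_M -> R) (i : 'I_M) : cookie r (lshift t i).+1 = r i.
Proof. by rewrite /cookie /= insubT //= => iM; congr (r _); exact: val_inj. Qed.

Lemma cookie_rshift (r : 'I_M -> R) (i : 'I_t) :
  cookie r (rshift M i).+1 = 2^-1.
Proof. by rewrite /cookie insubF //= ltnNge leq_addr. Qed.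

Lemma cookies_then_coins_weight (r : 'I_M -> R) (al : {ffun 'I_(M + t) -> bool}) :
  \prod_(j < M + t) bernoulli_weight (cookie r j.+1) (al j) =
  (\prod_i bernoulli_weight (r i) (al (lshift t i))) / 2 ^+ t.
Proof.
rewrite big_split_ord /=; congr (_ * _).
  by apply: eq_bigr => i _; rewrite cookie_lshift.
under eq_bigr => i _.
  have -> : bernoulli_weight (cookie r (rshift M i).+1) (al (rshift M i)) = 2^-1.
    by rewrite cookie_rshift /bernoulli_weight; case: (al _) => //; field.
  over.
by rewrite prodr_const card_ord exprVn.
Qed.

Lemma lower_law (al : {ffun 'I_(M + t) -> bool}) :
  \sum_(s : site_stack M t | [forall j : 'I_(M + t), lower_arrows s j == al j])
     stack_weight s =
  \prod_(j < M + t) bernoulli_weight (cookie p j.+1) (al j).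
Proof.
rewrite cookies_then_coins_weight.
rewrite (eq_bigl _ _ (fun s => cookies_then_coins_ord _ s.2 al)).
pose y0 := [ffun i => al (lshift t i)]; pose c0 := [ffun i => al (rshift M i)].
transitivity ((\sum_z pi y0 z) / 2 ^+ t); last first.
  rewrite (coupling_fst pq); congr (_ / _).
  by apply: eq_bigr => i _; rewrite ffunE.
rewrite mulr_suml big_mkcond.
rewrite -(pair_bigA _ (fun u c => if (u.1 == y0) && (c == c0)
   then pi u.1 u.2 / 2 ^+ t else 0)) /=.
rewrite -(pair_bigA _ (fun y z => \sum_c if (y == y0) && (c == c0)
   then pi y z / 2 ^+ t else 0)) /=.
rewrite (bigD1 y0) //= [X in _ + X]big1 ?addr0; last first.
  by move=> y /negbTE ->; rewrite big1 // => z _; rewrite big1.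
apply: eq_bigr => z _; rewrite eqxx /= -big_mkcond /= big_pred1_eq //.
Qed.

Lemma upper_law (al : {ffun 'I_(M + t) -> bool}) :
  \sum_(s : site_stack M t | [forall j : 'I_(M + t), upper_arrows s j == al j])
     stack_weight s =
  \prod_(j < M + t) bernoulli_weight (cookie q j.+1) (al j).
Proof.
rewrite cookies_then_coins_weight.
rewrite (eq_bigl _ _ (fun s => cookies_then_coins_ord _ s.2 al)).
pose z0 := [ffun i => al (lshift t i)]; pose c0 := [ffun i => al (rshift M i)].
transitivity ((\sum_y pi y z0) / 2 ^+ t); last first.
  rewrite (coupling_snd pq); congr (_ / _).
  by apply: eq_bigr => i _; rewrite ffunE.
rewrite mulr_suml big_mkcond.
rewrite -(pair_bigA _ (fun u c => if (u.2 == z0) && (c == c0)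
   then pi u.1 u.2 / 2 ^+ t else 0)) /=.
rewrite -(pair_bigA _ (fun y z => \sum_c if (z == z0) && (c == c0)
   then pi y z / 2 ^+ t else 0)) /=.
apply: eq_bigr => y _.
rewrite (bigD1 z0) //= [X in _ + X]big1 ?addr0; last first.
  by move=> z /negbTE ->; rewrite big1.
by rewrite eqxx /= -big_mkcond /= big_pred1_eq.
Qed.

Lemma stack_weight_sum : \sum_s stack_weight s = 1.
Proof.
pose arrows (s : site_stack M t) := [ffun j : 'I_(M + t) => lower_arrows s j].
rewrite (partition_big arrows xpredT) //=.
under eq_bigr => al _.
  have -> : \sum_(s | arrows s == al) stack_weight s =
      \prod_(j < M + t) bernoulli_weight (cookie p j.+1) (al j).
    rewrite -lower_law; apply: eq_bigl => s; apply/eqP/forallP => [<- j|h].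
      by rewrite ffunE.
    by apply/ffunP => j; rewrite ffunE; apply/eqP/h.
  over.
rewrite -(bigA_distr_bigA (fun j : 'I_(M + t) => bernoulli_weight (cookie p j.+1))).
by apply: big1 => j _; exact: bernoulli_weight_sum.
Qed.

Lemma stack_cookies_weight y z :
  \sum_(s : site_stack M t) stack_weight s * (s.1 == (y, z))%:R = pi y z.
Proof.
rewrite -(pair_bigA _ (fun u (c : {ffun 'I_t -> bool}) =>
  stack_weight (u, c) * (u == (y, z))%:R)) /=.
rewrite (bigD1 (y, z)) //= [X in _ + X]big1 ?addr0; last first.
  by move=> u /negbTE ->; rewrite big1 // => c _; rewrite mulr0.
rewrite eqxx /stack_weight /=.
under eq_bigr do rewrite mulr1.
rewrite sumr_const card_ffun card_bool card_ord -[LHS]mulr_natr natrX mulfVK //.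
Qed.

(** Its point is that the right-hand side does not involve the horizon [t]. *)
Lemma stack_prefix_weight (L : nat) (pre : nat -> bool) : (L <= M + t)%N ->
  \sum_(s : site_stack M t)
     stack_weight s * [forall j : 'I_L, lower_arrows s j == pre j]%:R =
  \prod_(j < L) bernoulli_weight (cookie p j.+1) (pre j).
Proof.
move=> LM.
pose arrows (s : site_stack M t) := [ffun j : 'I_(M + t) => lower_arrows s j].
(* Positions beyond [L] are free, and their weights sum to one. *)
pose F (j : 'I_(M + t)) d :=
  if (j < L)%N && (d != pre j) then 0 else bernoulli_weight (cookie p j.+1) d.
transitivity (\sum_(al : {ffun 'I_(M + t) -> bool}) \prod_j F j (al j)).
  rewrite (partition_big arrows xpredT) //=; apply: eq_bigr => al _.
  transitivity (\sum_(s | arrows s == al) stack_weight s *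
      [forall j : 'I_(M + t), (j < L)%N ==> (al j == pre j)]%:R).
    apply: eq_bigr => s /eqP <-; congr (_ * _%:R); congr nat_of_bool.
    apply/forallP/forallP => h j.
      by apply/implyP => jL; rewrite ffunE; exact: (h (Ordinal jL)).
    by have := h (widen_ord LM j); rewrite ffunE /= ltn_ord.
  rewrite -mulr_suml.
  have -> : \sum_(s | arrows s == al) stack_weight s =
      \prod_(j < M + t) bernoulli_weight (cookie p j.+1) (al j).
    rewrite -lower_law; apply: eq_bigl => s; apply/eqP/forallP => [<- j|h].
      by rewrite ffunE.
    by apply/ffunP => j; rewrite ffunE; apply/eqP/h.
  have [/forallP h|/forallPn[j nj]] :=
    boolP [forall j : 'I_(M + t), (j < L)%N ==> (al j == pre j)].
    rewrite mulr1; apply: eq_bigr => j _; rewrite /F.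
    by case: ifP => // /andP[jL]; rewrite (implyP (h j) jL).
  rewrite mulr0 (bigD1 j) //= /F.
  by move: nj; rewrite negb_imply => ->; rewrite mul0r.
rewrite -(bigA_distr_bigA F) (big_ord_widen (M + t)
  (fun j => bernoulli_weight (cookie p j.+1) (pre j)) LM) [RHS]big_mkcond /=.
apply: eq_bigr => j _; rewrite /F; case: (j < L)%N => /=.
  rewrite (bigD1 (pre j)) //= eqxx big1 ?addr0 //= => d /negbTE.
  by move=> ->.
exact: bernoulli_weight_sum.
Qed.

End StackLaw.

(** * Lower bound on the expected number of gaining sites *)

Lemma lefts_before_prefix (h s k : nat) (a : nat -> bool) :
  (forall j, (j < s + k.+1)%N -> a j = (s <= j)%N) -> (s + k.+1 <= h)%N ->
  lefts_before h a k.+1 = s.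
Proof.
move=> aE sh.
have rE j : (j <= s + k.+1)%N -> rights a j = (j - s)%N.
  elim: j => [|j IH] js; first by rewrite rights0.
  by rewrite rightsS IH ?aE; lia.
have sumE : (\sum_(j < h) (j < s) = s)%N.
  rewrite -[RHS]card_ord -sum1_card.
  by rewrite (big_ord_widen h (fun=> 1%N)) ?[RHS]big_mkcond //=; lia.
rewrite -[RHS]sumE; apply: eq_bigr => j _; congr nat_of_bool.
have [js|js] := ltnP j (s + k.+1).
  rewrite aE // rE; last exact: ltnW.
  by rewrite -ltnNge; case: ltnP => //= _; lia.
have := leq_rights a js; rewrite rE //.
have -> : (j < s)%N = false by lia.
by move=> rj; rewrite [X in _ && X](_ : _ = false) ?andbF //; lia.
Qed.

Lemma cookie_bounds (R : realType) (M : nat) (p : 'I_M -> R) j :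
  cookie_env p -> 0 < cookie p j < 1.
Proof.
move=> pe; rewrite /cookie; case: insubP => [i _ _|_]; first exact: pe.
by apply/andP; split; lra.
Qed.

Lemma bernoulli_weight_gt0 (R : realType) (c : R) d :
  0 < c < 1 -> 0 < bernoulli_weight c d.
Proof. by move=> /andP[c0 c1]; case: d => //=; rewrite subr_gt0. Qed.

Lemma finite_lower_bound (R : realType) (f : nat -> R) (K : nat) :
  (forall l, 0 < f l) -> exists2 c, 0 < c & forall l, (l <= K)%N -> c <= f l.
Proof.
move=> f0; elim: K => [|K [c c0 cP]].
  by exists (f 0%N) => // l; rewrite leqn0 => /eqP ->.
exists (Num.min c (f K.+1)); first by rewrite lt_min c0 f0.
move=> l; rewrite leq_eqVlt => /orP[/eqP ->|/cP cl].
  by rewrite ge_min lexx orbT.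
by rewrite ge_min cl.
Qed.

Lemma eq_left_chain h A A' (N k : nat) :
  (forall j, (j < k)%N -> A (N%:Z - j.+1%:Z) = A' (N%:Z - j.+1%:Z)) ->
  left_chain h A N k = left_chain h A' N k.
Proof.
elim: k => [//|k IH] AA' /=; rewrite AA' // IH // => j jk.
by apply: AA'; exact: ltnW.
Qed.

(** A stack that begins with [s] left arrows followed by [l + 1] right arrows has
exactly [s] left arrows before its right arrow number [l + 1]. This prefix has a
positive weight, which is bounded below over the finitely many [l <= K] and does
not depend on [t]. *)
Lemma lefts_before_weight (R : realType) (M : nat) (p q : 'I_M -> R) pi
    (s K : nat) : cookie_env p -> cookie_coupling p q pi ->
  exists2 c : R, 0 < c & forall t l, (s + K.+1 <= t)%N -> (l <= K)%N ->
    c <= \sum_(u : site_stack M t) stack_weight pi u *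
           (lefts_before t (lower_arrows u) l.+1 == s)%:R.
Proof.
move=> pe pq.
pose f l := \prod_(j < s + l.+1) bernoulli_weight (cookie p j.+1) (s <= j)%N.
have [|c c0 cP] := @finite_lower_bound R f K.
  by move=> l; apply: prodr_gt0 => j _; exact/bernoulli_weight_gt0/cookie_bounds.
exists c => // t l st lK; apply: le_trans (cP _ lK) _.
rewrite /f -(stack_prefix_weight (t := t) pq (fun j => s <= j)%N); last by lia.
apply: ler_sum => u _; apply: ler_wpM2l; first exact: stack_weight_ge0 pq _.
rewrite ler_nat; have [/forallP h|//] :=
  boolP [forall j : 'I_(s + l.+1), lower_arrows u j == (s <= j)%N].
rewrite (lefts_before_prefix (s := s)) ?eqxx //; last by lia.
by move=> j js; exact/eqP/(h (Ordinal js)).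
Qed.

Section Gain.
Variables (R : realType) (M : nat) (p q : 'I_M -> R).
Variable pi : {ffun 'I_M -> bool} -> {ffun 'I_M -> bool} -> R.
Hypothesis pq : cookie_coupling p q pi.
Variables (t N : nat) (I : finType) (site : int -> I).
Hypothesis Nt : (N <= t)%N.
Hypothesis site_inj : {in [pred y : int | `|y| <= t%:Z] &, injective site}.

Definition lower_field (o : {ffun I -> site_stack M t}) (y : int) : nat -> bool :=
  lower_arrows (o (site y)).

Definition upper_field (o : {ffun I -> site_stack M t}) (y : int) : nat -> bool :=
  upper_arrows (o (site y)).

Local Notation E := (expectation (fun _ : I => @stack_weight R M t pi)).
Local Notation chain o k := (left_chain t (lower_field o) N k).

(** The chain up to [k] reads the stacks at the sites [N - 1], ..., [N - k] only. *)
Lemma left_chain_update o (k l : nat) u : (k <= l < N)%N ->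
  chain (update o (site (N%:Z - l.+1%:Z)) u) k = chain o k.
Proof.
move=> kl; apply: eq_left_chain => j jk; rewrite /lower_field update_neq //.
by apply/eqP => /site_inj; rewrite !inE => h; have := h _ _; lia.
Qed.

Definition gaining (K s : nat) y z (o : {ffun I -> site_stack M t}) (k : nat) :=
  [&& (chain o k <= K)%N, chain o k.+1 == s
    & (o (site (N%:Z - k.+2%:Z))).1 == (y, z)].

(** Resample the stack at [N - k - 2], which decides the last condition alone, then
the stack at [N - k - 1], which turns a chain value at most [K] into [s]. *)
Lemma expectation_gaining (K s k : nat) y z (c : R) : (k.+1 < N)%N ->
  (forall l, (l <= K)%N ->
    c <= \sum_(u : site_stack M t) stack_weight pi u *
           (lefts_before t (lower_arrows u) l.+1 == s)%:R) ->
  c * pi y z * E (fun o => (chain o k <= K)%N%:R) <=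
  E (fun o => (gaining K s y z o k)%:R).
Proof.
move=> kN cP; have w1 := stack_weight_sum t pq.
have w0 i u : 0 <= (fun _ : I => @stack_weight R M t pi) i u.
  exact: stack_weight_ge0 pq _.
pose mid o : R := ((chain o k <= K)%N && (chain o k.+1 == s))%:R.
have -> : E (fun o => (gaining K s y z o k)%:R) = E mid * pi y z.
  rewrite (expectation_update (i := site (N%:Z - k.+2%:Z)) _ w1).
  rewrite /expectation mulr_suml; apply: eq_bigr => o _.
  rewrite -mulrA -(stack_cookies_weight t pi) !mulr_sumr.
  apply: eq_bigr => u _; congr (_ * _).
  rewrite /gaining !left_chain_update ?updateE; try by lia.
  by rewrite andbA -mulnb natrM mulrCA.
rewrite mulrAC; apply: ler_wpM2r; first exact: coupling_ge0 pq _ _.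
rewrite [leRHS](expectation_update (i := site (N%:Z - k.+1%:Z)) _ w1).
rewrite /expectation mulr_sumr; apply: ler_sum => o _.
rewrite mulrCA; apply: ler_wpM2l.
  by apply: prodr_ge0 => i _; exact: w0 i _.
have -> : \sum_(u : site_stack M t)
      stack_weight pi u * mid (update o (site (N%:Z - k.+1%:Z)) u) =
    (chain o k <= K)%N%:R * \sum_(u : site_stack M t) stack_weight pi u *
      (lefts_before t (lower_arrows u) (chain o k).+1 == s)%:R.
  rewrite mulr_sumr; apply: eq_bigr => u _; rewrite [RHS]mulrCA; congr (_ * _).
  rewrite /mid -natrM mulnb /= left_chain_update; last by lia.
  by rewrite /lower_field updateE.
case: leqP => [lK|_]; last by rewrite mulr0 mul0r.
by rewrite mulr1 mul1r; exact: cP.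
Qed.

End Gain.

(** * Strict monotonicity of a positive speed *)

Definition deviates (R : realType) (v e : R) (N0 : nat) (ds : seq bool) : bool :=
  [exists n : 'I_(size ds).+1, (N0 <= n)%N &&
    (e * n%:R < `|(trail (take n ds)).1%:~R - v * n%:R|)].

(** Almost sure convergence to [v] of the position divided by time, in terms of
the law of the first [t] steps only: the deviations after time [N0] are unlikely,
uniformly in the horizon [t]. *)
Definition speed_in_probability (R : realType) (M : nat) (p : 'I_M -> R) (v : R) :=
  forall e dl : R, 0 < e -> 0 < dl -> exists N0 : nat, forall t : nat,
    \sum_(ds : t.-tuple bool)
       path_weight p origin ds * (deviates v e N0 ds)%:R <= dl.

Lemma not_deviates (R : realType) (v e : R) (N0 t n : nat) A :
  ~~ deviates v e N0 (steps A origin t) -> (N0 <= n <= t)%N ->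
  `|(walk A n).1%:~R - v * n%:R| <= e * n%:R.
Proof.
move=> /existsPn h /andP[N0n nt].
have nt' : (n < (size (steps A origin t)).+1)%N by rewrite size_steps.
have := h (Ordinal nt'); rewrite /= N0n /= trail_steps // -leNgt.
by [].
Qed.

Lemma hit_of_not_deviates (R : realType) (v e : R) (N0 N C t : nat) A :
  e <= v / 2 -> 2 <= v * C%:R -> t = (C * N)%N -> (0 < N)%N -> (N0 <= t)%N ->
  ~~ deviates v e N0 (steps A origin t) ->
  exists a, [/\ (a <= t)%N, (walk A a).1 = N%:Z &
    forall k, (k < a)%N -> (walk A k).1 < N%:Z].
Proof.
move=> ev CP tE N0' N0t good; apply: first_hit; first by rewrite ltz_nat.
have := not_deviates (n := t) good; rewrite leqnn N0t.
move=> /(_ isT); rewrite ler_norml => /andP[lo _].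
rewrite -(ler_int R); apply: (@le_trans _ _ ((v - e) * t%:R)).
  apply: (@le_trans _ _ (v / 2 * t%:R)).
    have : 2 * N%:R <= v * C%:R * N%:R by rewrite ler_wpM2r.
    by rewrite tE natrM -pmulrn => h; clear -h; lra.
  by rewrite ler_wpM2r //; clear -ev; lra.
by clear -lo; lra.
Qed.

(** The sum of the chain is at most the time [a <= C * N], so by Markov's inequality
at most a quarter of the [N] sites carry a value above [4 * C]. *)
Lemma many_small_left_counts A (N C a t : nat) :
  (walk A a).1 = N%:Z -> (forall k, (k < a)%N -> (walk A k).1 < N%:Z) ->
  (a <= t)%N -> (a <= C * N)%N -> (0 < C)%N -> (1 < N)%N ->
  (N <= 4 * \sum_(k < N.-1) (left_chain t A N k <= 4 * C))%N.
Proof.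
move=> aN fst at_ aC C0 N1.
have sum_chain : (\sum_(k < N.-1) left_chain t A N k <= a)%N.
  have inj : injective (fun k : 'I_N.-1 => N%:Z - (k : nat)%:Z).
    by move=> i j h; apply: val_inj => /=; lia.
  apply: leq_trans (sum_dep_le A a (r := [seq N%:Z - (k : nat)%:Z | k : 'I_N.-1]) _).
    rewrite big_image /=; apply: leq_sum => k _.
    have kN : (k <= N)%N by have := ltn_ord k; lia.
    rewrite -(left_chainE aN fst at_ kN).
    by have := rights_lefts (A (N%:Z - k%:Z)) ((walk A a).2 (N%:Z - k%:Z)); lia.
  by rewrite map_inj_uniq ?enum_uniq.
have split : (\sum_(k < N.-1) (left_chain t A N k <= 4 * C) +
    \sum_(k < N.-1) (4 * C < left_chain t A N k) = N.-1)%N.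
  rewrite -big_split /= -[RHS]card_ord -sum1_card.
  by apply: eq_bigr => k _; rewrite ltnNge; case: (_ <= _)%N.
have markov : (\sum_(k < N.-1) (4 * C < left_chain t A N k) * (4 * C) <= a)%N.
  apply: leq_trans sum_chain; apply: leq_sum => k _.
  by case: ltnP => //; rewrite ?mul1n // => /ltnW.
move: markov; rewrite -big_distrl /=; set b := (\sum_(k < N.-1) _)%N.
rewrite -/b in split => markov.
have : (b * 4 * C <= N * C)%N by rewrite -mulnA [(N * C)%N]mulnC; lia.
rewrite leq_pmul2r // => b4.
by move: split; set x := (\sum_(k < _) _)%N => split; clearbody x b; lia.
Qed.

(** Up to errors of order [e], [N = vp * a] and [N <= vq * k] with
[k <= a - g * N]. If [vq <= vp] this leaves [vp ^+ 2 * g] at most of order [e], against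
the choice of [e]. *)
Lemma speed_gap (R : realType) (vp vq e g : R) (N a k : nat) :
  0 < vp -> 0 < g -> e <= vp / 2 -> e <= vp ^+ 2 * g / 8 -> 0 < e ->
  (0 < N)%N -> `|N%:R - vp * a%:R| <= e * a%:R ->
  N%:R <= (vq + e) * k%:R -> k%:R + g * N%:R <= a%:R -> vp < vq.
Proof.
move=> vp0 g0 e1 e2 e0 N0; rewrite ler_norml => /andP[Na _] Nk ka.
rewrite ltNge; apply/negP => vqp.
have NR : 0 < N%:R :> R by rewrite ltr0n.
have a0 : 0 <= a%:R :> R by [].
have k0 : 0 <= k%:R :> R by [].
move: Na Nk ka NR a0 k0; set x := a%:R; set y := k%:R; set n := N%:R.
move=> Na Nk ka NR a0 k0.
have step1 : n <= (vp + e) * (x - g * n).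
  apply: le_trans Nk _; apply: (@le_trans _ _ ((vp + e) * y)).
    by rewrite ler_wpM2r // lerD2r.
  by rewrite ler_wpM2l; lra.
have step2 : (vp + e) * g * n <= 2 * e * x by nra.
have step3 : vp * x <= 2 * n by nra.
have egn : 0 <= e * g * n by rewrite !mulr_ge0 // ltW.
have step4 : vp * g * n <= 2 * e * x by nra.
have step5 : vp * (vp * g * n) <= vp * (2 * e * x) by rewrite ler_pM2l.
have step6 : e * (vp * x) <= e * (2 * n) by rewrite ler_pM2l.
have pos : 0 < vp * vp * g * n by rewrite !mulr_gt0.
have : e * n <= vp ^+ 2 * g / 8 * n by rewrite ler_wpM2r // ltW.
by rewrite expr2; nra.
Qed.

Definition site_index (t : nat) (y : int) : 'I_t.*2.+1 := inord `|(y + t%:Z)%R|%N.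

Lemma site_index_inj t :
  {in [pred y : int | `|y| <= t%:Z] &, injective (site_index t)}.
Proof.
move=> x y; rewrite !inE => xt yt /(congr1 (@nat_of_ord _)).
by rewrite !inordK; lia.
Qed.

(** The expected number of gaining sites is at least a fixed multiple of [N]. If
the speeds were not ordered, then outside the rare deviations of the two walks
[speed_gap] would keep the number of gaining sites below a smaller multiple of
[N], and on the deviations it is at most [N]. *)
Lemma speed_lt (R : realType) (M : nat) (p q : 'I_M -> R) pi (vp vq : R) :
  cookie_coupling p q pi -> cookie_env p ->
  speed_in_probability p vp -> speed_in_probability q vq ->
  0 < vp -> vp < vq.
Proof.
move=> pq pe sp sq vp0.
have [y [z [m [mM pi0 yz]]]] := coupling_lt pq.
have [s sE] : exists s, heads y m = s by exists (heads y m).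
rewrite sE in yz.
(* By the time [C * N] a walk with speed close to [vp] is beyond [N]. *)
have [C C0 CP] : exists2 C, (0 < C)%N & 2 <= vp * C%:R.
  exists (Num.truncn (2 / vp)).+1 => //.
  have : 2 / vp < (Num.truncn (2 / vp)).+1%:R by exact: truncnS_gt.
  by rewrite ltr_pdivrMr // mulrC => /ltW.
have [c c0 cP] := lefts_before_weight s (4 * C) pe pq.
(* The expected number of gaining sites will be at least [c * pi y z * N / 8],
   that is [4 * g * N], and without a strict inequality of the speeds it would
   be at most [g * N + 2 * dl * N <= 3 * g * N]. *)
have [g g0 gE] : exists2 g, 0 < g & c * pi y z = 32 * g.
  exists (c * pi y z / 32); last by field.
  by rewrite divr_gt0 // mulr_gt0.
have [e [e0 e1 e2]] : exists e, [/\ 0 < e, e <= vp / 2 & e <= vp ^+ 2 * g / 8].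
  exists (Num.min (vp / 2) (vp ^+ 2 * g / 8)); split.
  - by rewrite lt_min !divr_gt0 // mulr_gt0 // exprn_gt0.
  - by rewrite ge_min lexx.
  - by rewrite ge_min lexx orbT.
have [dl [dl0 dl2 dlg]] : exists dl, [/\ 0 < dl, dl <= 2^-1 & dl <= g].
  exists (Num.min (2^-1) g); split; first by rewrite lt_min g0 invr_gt0 ltr0n.
  - by rewrite ge_min lexx.
  - by rewrite ge_min lexx orbT.
have [Np NpP] := sp e dl e0 dl0; have [Nq NqP] := sq e dl e0 dl0.
have [N [N1 NpN NqN sN]] : exists N,
    [/\ 1 < N, Np <= N, Nq <= N & s + (4 * C).+1 <= N]%N.
  exists (2 + Np + Nq + (s + (4 * C).+1))%N; split.
  - by rewrite -!addnA.
  - by rewrite -addnA -addnA addnCA leq_addr.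
  - by rewrite addnAC leq_addl.
  - exact: leq_addl.
have [t tE] : exists t, t = (C * N)%N by exists (C * N)%N.
have Nt : (N <= t)%N by rewrite tE leq_pmull.
pose site := site_index t.
have inj := @site_index_inj t.
pose low (o : {ffun 'I_t.*2.+1 -> site_stack M t}) := lower_field site o.
pose upp (o : {ffun 'I_t.*2.+1 -> site_stack M t}) := upper_field site o.
pose bad_low o := deviates vp e Np (steps (low o) origin t).
pose bad_upp o := deviates vq e Nq (steps (upp o) origin t).
pose E := expectation (fun _ : 'I_t.*2.+1 => @stack_weight R M t pi).
have w1 : forall i : 'I_t.*2.+1, \sum_u @stack_weight R M t pi u = 1.
  by move=> _; exact: (stack_weight_sum t pq).
have w0 (i : 'I_t.*2.+1) u : 0 <= @stack_weight R M t pi u.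
  exact: (stack_weight_ge0 pq u).
have bad_lowP : E (fun o => (bad_low o)%:R) <= dl.
  apply: le_trans (NpP t); rewrite le_eqVlt; apply/orP; left; apply/eqP.
  apply: (@path_law R M p _ _ _ (@lower_arrows M t) (M + t)%N t site
    (fun ds => (deviates vp e Np ds)%:R) inj); first exact: leq_addl.
  exact: (lower_law pq).
have bad_uppP : E (fun o => (bad_upp o)%:R) <= dl.
  apply: le_trans (NqP t); rewrite le_eqVlt; apply/orP; left; apply/eqP.
  apply: (@path_law R M q _ _ _ (@upper_arrows M t) (M + t)%N t site
    (fun ds => (deviates vq e Nq ds)%:R) inj); first exact: leq_addl.
  exact: (upper_law pq).
have NR : 0 < N%:R :> R by rewrite ltr0n ltnW.
have hit o : ~~ bad_low o -> exists a, [/\ (a <= t)%N,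
    (walk (low o) a).1 = N%:Z &
    forall k, (k < a)%N -> (walk (low o) k).1 < N%:Z].
  apply: (hit_of_not_deviates e1 CP tE); first exact: ltnW.
  exact: leq_trans NpN Nt.
pose gains (o : {ffun 'I_t.*2.+1 -> site_stack M t}) k :=
  gaining N site (4 * C) s y z o k.
pose count (o : {ffun 'I_t.*2.+1 -> site_stack M t}) :=
  (\sum_(k < N.-1) gains o k)%N.
have count_small (o : {ffun 'I_t.*2.+1 -> site_stack M t}) :
    (forall i, 0 < @stack_weight R M t pi (o i)) ->
    ~~ (vp < vq) -> ~~ bad_low o -> ~~ bad_upp o -> (count o)%:R <= g * N%:R.
  move=> o0 nlt good_low good_upp; rewrite leNgt; apply: contra nlt => gain.
  have [a [at_ aN fst]] := hit o good_low.
  have order u : stack_le (low o u) (upp o u).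
    apply: (stack_le_of_coupling pq); have := o0 (site u).
    by rewrite /stack_weight pmulr_lgt0 // invr_gt0 exprn_gt0.
  pose ks := [seq k <- iota 0 N.-1 | gains o k].
  have ksE : size ks = count o.
    rewrite /count -(big_mkord xpredT (fun k => gains o k : nat)).
    by rewrite size_filter -sum1_count big_mkcond /index_iota subn0.
  have [|k|k ka Nk] :=
      @upper_walk_hits_earlier _ _ N t a m s ks order aN fst at_.
  - by rewrite filter_uniq ?iota_uniq.
  - rewrite mem_filter mem_iota add0n leq0n /=.
    move=> /andP[/and3P[_ /eqP ck /eqP yzk] kN]; split => //.
    + by rewrite -ltn_predRL.
    + by rewrite /low /lower_field /lower_arrows yzk rights_cookies // sE.
    + by rewrite /upp /upper_field /upper_arrows yzk rights_cookies.
  rewrite ksE in ka.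
  have kN : (N <= k)%N by have := pos_le (upp o) k; clear -Nk; lia.
  have aN' : (N <= a)%N by have := pos_le (low o) a; rewrite aN; clear; lia.
  apply: (@speed_gap R vp vq e g N a k) => //.
  - exact: ltnW.
  - have := not_deviates (n := a) good_low; rewrite aN -pmulrn; apply.
    by rewrite at_ andbT; exact: leq_trans aN'.
  - have := not_deviates (n := k) good_upp; rewrite (leq_trans NqN kN) /=.
    rewrite (leq_trans (leq_trans (leq_addr _ _) ka) at_) => /(_ isT).
    rewrite ler_norml => /andP[_ up].
    apply: (@le_trans _ _ ((walk (upp o) k).1%:~R)); last by clear -up; lra.
    by rewrite pmulrn ler_int.
  - apply: (@le_trans _ _ (k + count o)%:R); last by rewrite ler_nat.
    by rewrite natrD lerD2l ltW.
have count_large : c * pi y z * (N%:R / 4) * (1 - dl) <= E (fun o => (count o)%:R).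
  have -> : E (fun o => (count o)%:R) =
      \sum_(k < N.-1) E (fun o => (gains o k)%:R).
    rewrite -expectation_sum /E; congr expectation; apply/funext => o.
    by rewrite /count natr_sum.
  apply: (@le_trans _ _ (\sum_(k < N.-1)
      c * pi y z * E (fun o => (left_chain t (low o) N k <= 4 * C)%N%:R))); last first.
    apply: ler_sum => k _; apply: (expectation_gaining pq Nt inj).
      by rewrite -ltn_predRL.
    by move=> l lC; apply: cP => //; exact: leq_trans Nt.
  rewrite -mulr_sumr -expectation_sum -mulrA; apply: ler_wpM2l.
    by rewrite mulr_ge0 // ltW.
  apply: (@le_trans _ _ (E (fun o => N%:R / 4 + - (N%:R / 4) * (bad_low o)%:R))).
    rewrite /E expectationD expectation_cst // expectationZ -/E mulrBr mulr1 mulNr.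
    by rewrite lerD2l lerN2 ler_wpM2l // divr_ge0.
  apply: (expectation_le w0) => o _.
  have [_|good] := boolP (bad_low o).
    by rewrite mulr1 subrr; apply: sumr_ge0.
  rewrite mulr0 addr0 ler_pdivrMr // mulrC.
  have [a [at_ aN fst]] := hit o good.
  have aC : (a <= C * N)%N by rewrite -tE.
  have := many_small_left_counts aN fst at_ aC C0 N1.
  by rewrite -(ler_nat R N) natrM natr_sum.
have [//|nlt] := boolP (vp < vq).
have count_le : E (fun o => (count o)%:R) <= g * N%:R + N%:R * (dl + dl).
  apply: (@le_trans _ _ (E (fun o => g * N%:R +
      N%:R * ((bad_low o)%:R + (bad_upp o)%:R)))); last first.
    rewrite /E expectationD expectation_cst // lerD2l expectationZ expectationD.
    by rewrite ler_wpM2l // lerD.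
  apply: (expectation_le w0) => o o0.
  have cN : (count o)%:R <= N%:R :> R.
    rewrite ler_nat; apply: (@leq_trans (\sum_(k < N.-1) 1)).
      by apply: leq_sum => k _; case: (gains o k).
    by rewrite sum1_card card_ord leq_pred.
  have gN : 0 <= g * N%:R by rewrite mulr_ge0 // ltW.
  have := count_small o o0 nlt.
  have big (b : R) : 1 <= b -> (count o)%:R <= g * N%:R + N%:R * b.
    move=> b1; apply: le_trans cN _; rewrite -[leLHS]add0r lerD //.
    by rewrite ler_peMr.
  case: (bad_low o); case: (bad_upp o) => /= h.
  - by apply: big; rewrite lerDl.
  - by apply: big; rewrite addr0.
  - by apply: big; rewrite add0r.
  - by rewrite addr0 mulr0 addr0; exact: h.
exfalso.
have := le_trans count_large count_le; rewrite gE.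
clear -g0 NR dl0 dl2 dlg; set n := N%:R; rewrite -/n in NR *; move=> H.
have gN : 0 < g * n by rewrite mulr_gt0.
have : n * dl <= n * g by rewrite ler_pM2l.
have : g * n * 2^-1 <= g * n * (1 - dl) by rewrite ler_pM2l //; lra.
by lra.
Qed.

(** * Sequences of directions whose law is the path weight *)

Local Open Scope classical_set_scope.

Lemma trail_rcons ds d : trail (rcons ds d) = move (trail ds) d.
Proof. by rewrite /trail foldl_rcons. Qed.

Lemma trail_departures ds y :
  (trail ds).2 y = (\sum_(k < size ds) ((trail (take k ds)).1 == y))%N.
Proof.
elim/last_ind: ds => [|ds d IH]; first by rewrite big_ord0.
rewrite size_rcons big_ord_recr trail_rcons /= IH; congr addn.
  apply: eq_bigr => k _; rewrite -cats1 takel_cat //; exact: ltnW.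
by rewrite -cats1 takel_cat // take_size eq_sym.
Qed.

(** Consecutive positions reveal the directions. This is what makes the
filtration of the positions as fine as that of the directions. *)
Lemma trail_inj ds ds' : size ds = size ds' ->
  (forall k, (k <= size ds)%N -> (trail (take k ds)).1 = (trail (take k ds')).1) ->
  ds = ds'.
Proof.
elim/last_ind: ds ds' => [|ds d IH] ds'; first by case: ds'.
case/lastP: ds' => [|ds' d']; rewrite !size_rcons // => -[sz] h.
have e : ds = ds'.
  apply: IH => // k ks; have := h k (leqW ks).
  by rewrite -!cats1 !takel_cat -?sz.
rewrite -e in h *; have := h (size ds).+1 (leqnn _).
rewrite !take_oversize ?size_rcons // !trail_rcons /=.
by case: d d' {h} => -[] //; lia.
Qed.

Lemma path_weight_rcons (R : realType) (M : nat) (p : 'I_M -> R) ds d :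
  path_weight p origin (rcons ds d) = path_weight p origin ds *
    bernoulli_weight (cookie p ((trail ds).2 (trail ds).1).+1) d.
Proof.
rewrite /trail; elim: ds origin => [|e ds IH] st /=.
  by rewrite mulr1 mul1r.
by rewrite IH mulrA.
Qed.

Section Realization.
Variables (R : realType) (M : nat) (p : 'I_M -> R).
Variables (d : measure_display) (T : measurableType d) (P : probability T R).
Variable dirs : nat -> T -> seq bool.
Hypothesis size_dirs : forall n w, size (dirs n w) = n.
Hypothesis take_dirs : forall m n w, (m <= n)%N -> take m (dirs n w) = dirs m w.
Hypothesis measurable_fiber : forall n ds, measurable (dirs n @^-1` [set ds]).
Hypothesis dirs_law : forall n ds, size ds = n ->
  P (dirs n @^-1` [set ds]) = (path_weight p origin ds)%:E.

Definition position (n : nat) (w : T) : int := (trail (dirs n w)).1.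

Lemma position_take n w k : (k <= n)%N ->
  position k w = (trail (take k (dirs n w))).1.
Proof. by move=> kn; rewrite take_dirs. Qed.

Lemma visits_position n w :
  visits position n w = ((trail (dirs n w)).2 (position n w)).+1.
Proof.
rewrite /visits trail_departures size_dirs -sum1_card big_mkcond /=.
rewrite big_ord_recr /= unfold_in /= eqxx addn1; congr S.
apply: eq_bigr => k _; rewrite unfold_in /= (@position_take n) ?(ltnW (ltn_ord k)) //.
Qed.

Lemma preimage_dirs n (Q : set (seq bool)) :
  dirs n @^-1` Q =
  \bigcup_(ds in [set ds : n.-tuple bool | Q ds]) dirs n @^-1` [set val ds].
Proof.
apply/seteqP; split => [w /= Qw|w [ds /= Qds ->] //].
by exists (Tuple (introT eqP (size_dirs n w))).
Qed.

Lemma measurable_dirs n (Q : set (seq bool)) : measurable (dirs n @^-1` Q).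
Proof.
rewrite preimage_dirs; apply: fin_bigcup_measurable => [|ds _].
  exact: finite_finset.
exact: measurable_fiber.
Qed.

Lemma measurable_fun_dirs (d' : measure_display) (U : measurableType d')
    (h : seq bool -> U) n (D : set T) :
  measurable D -> measurable_fun D (fun w => h (dirs n w)).
Proof.
move=> mD _ Y mY; apply: measurableI => //.
exact: (measurable_dirs n (h @^-1` Y)).
Qed.

Lemma filtration_of_directions n (Q : set (seq bool)) :
  natural_filtration position n (dirs n @^-1` Q).
Proof.
rewrite preimage_dirs /natural_filtration.
set G := (X in <<s X >>).
suff : @measurable _ (g_sigma_algebraType G)
  (\bigcup_(ds in [set ds : n.-tuple bool | Q ds]) dirs n @^-1` [set val ds]) by [].
apply: fin_bigcup_measurable => [|ds _]; first exact: finite_finset.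
have -> : dirs n @^-1` [set val ds] =
    \bigcap_(k in [set k : nat | (k <= n)%N])
      position k @^-1` [set (trail (take k ds)).1].
  apply/seteqP; split => [w /= dw k /= kn|w /= h].
    by rewrite (position_take _ kn) dw.
  apply: trail_inj; rewrite ?size_dirs ?size_tuple // => k kn.
  by rewrite -(h k kn) (position_take _ kn).
apply: bigcap_measurable; first by exists 0%N.
move=> k kn; apply: sub_sigma_algebra.
by exists k, [set (trail (take k ds)).1].
Qed.

Lemma directions_of_filtration n (A : set T) :
  natural_filtration position n A -> exists Q, A = dirs n @^-1` Q.
Proof.
apply: (@smallest_sub _ _ _ [set A | exists Q, A = dirs n @^-1` Q]).
  split.
  - by exists set0; rewrite preimage_set0.
  - by move=> B [Q ->]; exists (~` Q); rewrite setTD preimage_setC.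
  - move=> F FQ; have [Q QP] := choice FQ.
    exists (\bigcup_i Q i); rewrite preimage_bigcup; apply: eq_bigcup => //.
move=> B [k [C [kn ->]]] /=.
exists [set ds | C (trail (take k ds)).1].
by apply/seteqP; split => w /=; rewrite (position_take _ kn).
Qed.

Lemma preimage_dirs_bigsetU n (Q : set (seq bool)) :
  dirs n @^-1` Q =
  \big[setU/set0]_(ds <- [seq ds <- enum {: n.-tuple bool} | `[< Q (val ds) >]])
    dirs n @^-1` [set val ds].
Proof.
rewrite preimage_dirs -bigcup_seq; apply: eq_bigcupl; split => ds /=.
  by move=> Qds; rewrite mem_filter mem_enum andbT; exact/asboolP.
by rewrite mem_filter => /andP[/asboolP].
Qed.

Lemma trivIset_fibers n (D : set (n.-tuple bool)) :
  trivIset D (fun ds => dirs n @^-1` [set val ds]).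
Proof. by move=> ds ds' _ _ [w [/= dw dw']]; apply: val_inj; rewrite /= -dw -dw'. Qed.

(** The fibres of [dirs n] form a finite partition adapted to the event, so both
integrals are sums over it. *)
Lemma eq_integral_directions n (Q : set (seq bool)) (f g : T -> \bar R) :
  measurable_fun setT f -> measurable_fun setT g ->
  (forall w, 0 <= f w)%E -> (forall w, 0 <= g w)%E ->
  (forall ds : n.-tuple bool, \int[P]_(w in dirs n @^-1` [set val ds]) f w =
     \int[P]_(w in dirs n @^-1` [set val ds]) g w)%E ->
  (\int[P]_(w in dirs n @^-1` Q) f w = \int[P]_(w in dirs n @^-1` Q) g w)%E.
Proof.
move=> mf mg f0 g0 fg.
have mQ := measurable_dirs n Q.
rewrite preimage_dirs_bigsetU in mQ *.
rewrite !ge0_integral_bigsetU //; try exact: filter_uniq (enum_uniq _);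
  try exact: trivIset_fibers; try exact: measurable_funTS;
  try by move=> ds; exact: measurable_fiber.
by apply: eq_bigr => ds _; exact: fg.
Qed.

(** An event of the filtration is a union of fibres of [dirs n], and on a fibre both
sides equal the weight of the path extended by [b]. *)
Lemma next_direction_law n (b : bool) : cookie_env p ->
  is_cond_prob P (natural_filtration position n)
    [set w | dirs n.+1 w = rcons (dirs n w) b]
    (fun w => bernoulli_weight (cookie p (visits position n w)) b).
Proof.
move=> pe.
pose g ds := bernoulli_weight (cookie p ((trail ds).2 (trail ds).1).+1) b.
have gE : (fun w => bernoulli_weight (cookie p (visits position n w)) b) =
    g \o dirs n by apply/funext => w; rewrite visits_position.
have mB : measurable [set w | dirs n.+1 w = rcons (dirs n w) b].
  have -> : [set w | dirs n.+1 w = rcons (dirs n w) b] =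
      dirs n.+1 @^-1` [set ds | ds = rcons (take n ds) b].
    by apply/seteqP; split => w /=; rewrite take_dirs.
  exact: measurable_dirs.
rewrite gE; split => [Y _|A /directions_of_filtration [Q ->]].
  rewrite comp_preimage; exact: filtration_of_directions.
rewrite setIC -integral_indic //; last exact: measurable_dirs.
apply: eq_integral_directions.
- by apply/measurable_EFinP; exact: measurable_indic.
- by apply/measurable_EFinP; exact: measurable_fun_dirs.
- by move=> w; rewrite lee_fin.
- by move=> w; rewrite lee_fin ltW // bernoulli_weight_gt0 // cookie_bounds.
move=> ds; rewrite integral_indic //.
rewrite (_ : _ `&` _ = dirs n.+1 @^-1` [set rcons ds b]); last first.
  apply/seteqP; split => [w [/= -> ->] //|w /= dw].
  have dE : dirs n w = ds.
    by rewrite -(@take_dirs n n.+1) // dw -cats1 take_size_cat ?size_tuple.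
  by rewrite /= dw dE.
transitivity (path_weight p origin (rcons ds b))%:E.
  by apply: dirs_law; rewrite size_rcons size_tuple.
rewrite path_weight_rcons -/(g ds).
under eq_integral => w.
  rewrite inE /= => ->.
  over.
rewrite (integral_cst _ (measurable_fiber _ _)) mulrC EFinM; congr (_ * _)%E.
by apply/esym/dirs_law; rewrite size_tuple.
Qed.

Lemma excited_random_walk_position : cookie_env p ->
  excited_random_walk p P position.
Proof.
move=> pe.
have stepE n w : exists b, dirs n.+1 w = rcons (dirs n w) b.
  exists (last true (dirs n.+1 w)); rewrite -(@take_dirs n n.+1) //.
  have := size_dirs n.+1 w; case/lastP: (dirs n.+1 w) => [//|s b].
  by rewrite size_rcons last_rcons -cats1 => -[sn]; rewrite take_size_cat // cats1.
have stepB n (b : bool) (e : int) : e = (if b then 1 else -1) ->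
    [set w | position n.+1 w = position n w + e] =
    [set w | dirs n.+1 w = rcons (dirs n w) b].
  move=> ->; apply/seteqP; split => w /=; rewrite /position; last first.
    by move=> ->; rewrite trail_rcons; case: b.
  have [b' ->] := stepE n w; rewrite trail_rcons /=.
  by case: b; case: b' => //; lia.
split.
- by move=> n B; exact: (measurable_dirs n [set ds | B (trail ds).1]).
- rewrite (_ : [set w | _] = setT) ?probability_setT //.
  apply/seteqP; split => w //= _; rewrite /position.
  by have /size0nil -> := size_dirs 0 w.
- by move=> n; rewrite (stepB n true) //; exact: next_direction_law.
- by move=> n; rewrite (stepB n false) //; exact: next_direction_law.
Qed.

Lemma probability_directions n (Q : pred (seq bool)) :
  P (dirs n @^-1` [set ds | Q ds]) =
  (\sum_(ds : n.-tuple bool) path_weight p origin ds * (Q ds)%:R)%:E.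
Proof.
have mQ := measurable_dirs n [set ds | Q ds].
transitivity (\int[P]_(w in dirs n @^-1` [set ds | Q ds]) cst 1 w)%E.
  by rewrite integral_cst // mul1e.
rewrite preimage_dirs_bigsetU in mQ *.
rewrite ge0_integral_bigsetU //; try exact: filter_uniq (enum_uniq _);
  try exact: trivIset_fibers; try by move=> ds; exact: measurable_fiber.
rewrite big_filter big_mkcond -sumEFin big_enum; apply: eq_bigr => ds _ /=.
rewrite asboolb; case: (Q ds); last by rewrite mulr0.
rewrite (integral_cst _ (measurable_fiber _ _)) mul1e mulr1.
by apply: dirs_law; rewrite size_tuple.
Qed.

Let deviation (v e : R) (N : nat) : set T :=
  [set w | exists2 n, (N <= n)%N &
    e * n%:R < `|(position n w)%:~R - v * n%:R|].

Lemma measurable_deviation v e N : measurable (deviation v e N).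
Proof.
pose Q n := [set ds | e * n%:R < `|(trail ds).1%:~R - v * n%:R|].
rewrite (_ : deviation v e N = \bigcup_(n in [set n | (N <= n)%N]) dirs n @^-1` Q n).
  by apply: bigcup_measurable => n _; exact: measurable_dirs.
by apply/seteqP; split => w [n Nn h]; exists n.
Qed.

Lemma deviation_speed v e w : 0 < e ->
  (fun n : nat => (position n w)%:~R / n%:R : R) @ \oo --> v ->
  exists N, ~ deviation v e N w.
Proof.
move=> e0 /cvgrPdist_le /(_ e e0) [N _ NP]; exists (maxn N 1) => -[n].
rewrite geq_max => /andP[Nn n0]; have nR : 0 < n%:R :> R by rewrite ltr0n.
have := NP n Nn; rewrite /= -(ler_pM2r nR) => h; apply/negP; rewrite -leNgt distrC.
have -> : v * n%:R - (position n w)%:~R = (v - (position n w)%:~R / n%:R) * n%:R.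
  by rewrite mulrBl divfK // gt_eqF.
by rewrite normrM (gtr0_norm nR).
Qed.

(** The events of a deviation after time [N] decrease with [N] to a set of points
without convergence, hence to a null set; their probabilities tend to zero and
bound the weight of the paths that deviate between the times [N] and [t]. *)
Lemma speed_in_probability_of_limiting_speed v : cookie_env p ->
  limiting_speed p v -> speed_in_probability p v.
Proof.
move=> pe /(_ _ _ P position (excited_random_walk_position pe)) as_cvg e dl e0 dl0.
have P0 : P (\bigcap_N deviation v e N) = 0%E.
  apply/(negligibleP P).
    by apply: bigcapT_measurable => N; exact: measurable_deviation.
  apply: negligibleS as_cvg => w /= dev cvgw.
  by have [N] := deviation_speed e0 cvgw; apply; exact: dev.
have : (P \o deviation v e) @ \oo --> P (\bigcap_N deviation v e N).
  apply: nonincreasing_cvg_mu.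
  - by rewrite -ge0_fin_numE // fin_num_measure //; exact: measurable_deviation.
  - by move=> N; exact: measurable_deviation.
  - by apply: bigcapT_measurable => N; exact: measurable_deviation.
  move=> N N' NN'; apply/subsetPset => w [n N'n h].
  by exists n => //; exact: leq_trans N'n.
rewrite P0 => /(_ [set y | (y < dl%:E)%E]) /=.
case; first by apply: open_ereal_lt'; rewrite lte_fin.
move=> N _ /(_ N (leqnn _)) /= PN; exists N => t.
rewrite -lee_fin -probability_directions; apply: le_trans (ltW PN).
apply: le_measure; rewrite ?inE; [exact: measurable_dirs|exact: measurable_deviation|].
move=> w /= /existsP[n /andP[Nn h]]; exists n => //.
have nt : (n <= t)%N by rewrite -ltnS -{2}(size_dirs t w) ltn_ord.
by move: h; rewrite take_dirs.
Qed.

End Realization.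

(** * A realization of the walk on the unit interval *)

Section UnitInterval.
Variables (R : realType) (M : nat) (p : 'I_M -> R).

(** For [u] uniform on the unit interval, [u < c] is a coin of bias [c],
and [rescale c u] is again uniform and independent of that coin: it supplies the
later steps. *)
Definition rescale (c u : R) : R := if u < c then u / c else (u - c) / (1 - c).

Fixpoint directions (st : walk_state) (u : R) (n : nat) : seq bool :=
  if n is n'.+1 then
    let c := cookie p (st.2 st.1).+1 in
    (u < c) :: directions (move st (u < c)) (rescale c u) n'
  else [::].

Lemma size_directions st u n : size (directions st u n) = n.
Proof. by elim: n st u => //= n IH st u; rewrite IH. Qed.

Lemma take_directions st u m n : (m <= n)%N ->
  take m (directions st u n) = directions st u m.
Proof. by elim: n m st u => [|n IH] [|m] st u //= mn; rewrite IH. Qed.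

Lemma measurable_directions st n ds :
  measurable ((fun u => directions st u n) @^-1` [set ds]).
Proof.
elim: n st ds => [|n IH] st [|d ds] /=.
- by rewrite (_ : _ @^-1` _ = setT); [exact: measurableT|exact/seteqP].
- by rewrite (_ : _ @^-1` _ = set0); [exact: measurable0|apply/seteqP; split => u].
- by rewrite (_ : _ @^-1` _ = set0); [exact: measurable0|apply/seteqP; split => u].
set c := cookie _ _.
pose f (u : R) := if d then u / c else (u - c) / (1 - c).
have mf : measurable_fun setT f.
  rewrite /f; case: (d); first exact: measurable_funM.
  by apply: measurable_funM => //; exact: measurable_funB.
have mlt : measurable [set u : R | (u < c) = d].
  have m : measurable [set u : R | u < c].
    by rewrite (_ : [set _ | _] = `]-oo, c[) //;
      apply/seteqP; split => u /=; rewrite in_itv.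
  case: d {f mf}; first by [].
  rewrite (_ : [set _ | _] = ~` [set u | u < c]); first exact: measurableC.
  by apply/seteqP; split => u /= => [->|/negP/negbTE].
rewrite (_ : _ @^-1` _ = [set u : R | (u < c) = d] `&`
    f @^-1` ((fun u => directions (move st d) u n) @^-1` [set ds])).
  apply: measurableI => //; rewrite -[X in measurable X]setTI.
  by apply: mf => //; exact: IH.
apply/seteqP; split => u /= => [[ud <-]|[ud]].
  by rewrite /f /rescale ud; case: (d).
by rewrite /f /rescale ud => <-; case: (d).
Qed.

Hypothesis pe : cookie_env p.

(** Prescribing one more direction restricts [u] to one of the two sides of [c],
each of which [rescale] maps affinely onto the unit interval. So the preimage of
an interval is an interval, with its length multiplied by [c] or by [1 - c]. *)
Lemma directions_itv ds st : exists a, [/\ 0 <= a, a + path_weight p st ds <= 1,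
  0 <= path_weight p st ds &
  forall u, 0 <= u < 1 -> (directions st u (size ds) == ds) =
    (a <= u < a + path_weight p st ds)].
Proof.
elim: ds st => [|d ds IH] st /=.
  by exists 0; split; rewrite ?add0r //; move=> u ->.
set c := cookie _ _; have /andP[c0 c1] : 0 < c < 1 by exact: cookie_bounds.
have [a [a0 a1 w0 aP]] := IH (move st d).
move: a1 w0 aP; set w := path_weight _ _ _ => a1 w0 aP.
have c1' : 0 < 1 - c by rewrite subr_gt0.
exists (if d then c * a else c + (1 - c) * a).
case: d @w aP a1 w0 => w aP a1 w0 /=.
  split; first by rewrite mulr_ge0 // ltW.
  - by rewrite -mulrDr mulr_ile1 ?addr_ge0 ?(ltW c0) ?(ltW c1).
  - by rewrite mulr_ge0 // ltW.
  move=> u /andP[u0 u1]; rewrite eqseq_cons /rescale -mulrDr.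
  case: ltP => uc /=; last first.
    by apply/esym/negbTE; rewrite negb_and -!ltNge -leNgt; apply/orP; right; nra.
  rewrite aP; last by rewrite divr_ge0 ?(ltW c0) //= ltr_pdivrMr ?mul1r.
  by rewrite ler_pdivlMr // ltr_pdivrMr // !(mulrC c).
split; first by rewrite addr_ge0 ?mulr_ge0 // ltW.
- by nra.
- by rewrite mulr_ge0 // ltW.
move=> u /andP[u0 u1]; rewrite eqseq_cons /rescale -addrA -mulrDr.
case: ltP => uc /=.
  by apply/esym/negbTE; rewrite negb_and -!ltNge; apply/orP; left; nra.
rewrite aP; last first.
  by rewrite divr_ge0 ?subr_ge0 ?(ltW c1) //= ltr_pdivrMr // mul1r ltrD2r.
by rewrite ler_pdivlMr // ltr_pdivrMr // !(mulrC (1 - c)) lerBrDl ltrBlDl.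
Qed.

Lemma uniform_prob_itv (a b : R) : 0 <= a -> a <= b -> b <= 1 ->
  uniform_prob (@ltr01 R) `[a, b[ = (b - a)%:E.
Proof.
move=> a0 ab b1; rewrite /uniform_prob (eq_integral (cst 1%E)).
  rewrite integral_cst ?mul1e //= lebesgue_measure_itv /= lte_fin.
  by move: ab; rewrite le_eqVlt => /orP[/eqP ->|->]; rewrite ?ltxx ?subrr ?EFinB.
move=> u; rewrite inE /= in_itv /= => /andP[au ub]; rewrite /uniform_pdf subr0 invr1.
by rewrite (le_trans a0 au) (ltW (lt_le_trans ub b1)).
Qed.

(** The uniform law does not charge the complement of the half-open interval on
which [directions_itv] applies. *)
Lemma directions_law n ds : size ds = n ->
  uniform_prob (@ltr01 R) ((fun u => directions origin u n) @^-1` [set ds]) =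
  (path_weight p origin ds)%:E.
Proof.
move=> <-; set S := _ @^-1` _.
pose P : probability (measurableTypeR R) R := uniform_prob (@ltr01 R).
change (P (S : set (measurableTypeR R)) = (path_weight p origin ds)%:E).
have mS : measurable S by exact: measurable_directions.
have [a [a0 a1 w0 aP]] := directions_itv ds origin.
have mI : measurable (`[0, 1[ : set R) by exact: measurable_itv.
have PI : P (~` `[0, 1[) = 0%E.
  rewrite probability_setC // [X in (_ - X)%E](_ : _ = 1%E) ?subee //.
  by apply: etrans (uniform_prob_itv _ _ _) _; rewrite ?subr0.
have -> : P S = P (S `&` `[0, 1[).
  rewrite (measureDI P mS mI) [X in (X + _)%E](_ : _ = 0%E) ?add0e //.
  apply: (subset_measure0 (mu := P) _ _ _ PI) => //.
  - exact: measurableD.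
  - exact: measurableC.
have -> : S `&` `[0, 1[ = `[a, a + path_weight p origin ds[.
  apply/seteqP; split => u /=; rewrite !in_itv /=.
    by move=> [/eqP Su uI]; rewrite -aP.
  move=> au; have uI : 0 <= u < 1.
    by move: au => /andP[au ua]; rewrite (le_trans a0 au) (lt_le_trans ua a1).
  by split => //; apply/eqP; rewrite aP.
by apply: etrans (uniform_prob_itv _ _ _) _; rewrite ?lerDl // addrC addKr.
Qed.

End UnitInterval.

Lemma limiting_speed_in_probability (R : realType) (M : nat) (p : 'I_M -> R) v :
  cookie_env p -> limiting_speed p v -> speed_in_probability p v.
Proof.
move=> pe; apply: (speed_in_probability_of_limiting_speed
  (P := uniform_prob (@ltr01 R)) (dirs := fun n u => directions p origin u n)) => //.
- by move=> n u; exact: size_directions.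
- by move=> m n u; exact: take_directions.
- by move=> n ds; exact: measurable_directions.
- by move=> n ds; exact: directions_law.
Qed.

(** * From coupled random vectors to a joint weight *)

Lemma total_probability (R : realType) (d : measure_display)
    (T : measurableType d) (P : probability T R) (S : finType) (f : T -> S)
    (A : set T) :
  measurable A -> (forall s, measurable (f @^-1` [set s])) ->
  P A = (\sum_s P (A `&` f @^-1` [set s]))%E.
Proof.
move=> mA mf.
have {1}-> : A = \bigcup_(s in [set` index_enum S]) (A `&` f @^-1` [set s]).
  apply/seteqP; split => [w Aw|w [s _ []] //].
  by exists (f w) => //=; rewrite mem_index_enum.
rewrite measure_fin_bigcup.
- by rewrite -fsbig_seq // index_enum_uniq.
- exact: finite_seq.
- by move=> s s' _ _ [w [[_ <-] [_ <-]]].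
- by move=> s _; exact: measurableI.
Qed.

Section EnvCoupling.
Variables (R : realType) (M : nat) (p q : 'I_M -> R).
Variables (d : measure_display) (T : measurableType d) (P : probability T R).

Definition outcome (Y : 'I_M -> {RV P >-> bool}) (w : T) : {ffun 'I_M -> bool} :=
  [ffun j => Y j w].

Implicit Types Y Z : 'I_M -> {RV P >-> bool}.

Lemma partial_sum_outcome Y m w :
  partial_sum Y m w = heads (outcome Y w) m.
Proof. by apply: eq_bigr => j _; rewrite ffunE. Qed.

Lemma outcome_fiber Y y :
  outcome Y @^-1` [set y] = \bigcap_(j in [set: 'I_M]) (Y j @^-1` [set y j]).
Proof.
apply/seteqP; split => [w /= <- j _|w /= h]; first by rewrite /= ffunE.
by apply/ffunP => j; rewrite ffunE; exact: h.
Qed.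

Lemma measurable_outcome Y y : measurable (outcome Y @^-1` [set y]).
Proof.
rewrite outcome_fiber; apply: fin_bigcap_measurable => [|j _].
  exact: finite_finset.
by rewrite -[X in measurable X]setTI; apply: (measurable_funPT (Y j)).
Qed.

Lemma bernoulli_prob_set1 (c : R) b : 0 < c < 1 ->
  bernoulli_prob c [set b] = (bernoulli_weight c b)%:E.
Proof.
move=> /andP[c0 c1]; rewrite /bernoulli_prob !ltW //= fsbig_set1.
by rewrite /bernoulli_pmf /bernoulli_weight.
Qed.

Lemma outcome_law (r : 'I_M -> R) Y y : cookie_env r -> independent_bernoulli r Y ->
  P (outcome Y @^-1` [set y]) = (\prod_j bernoulli_weight (r j) (y j))%:E.
Proof.
move=> re [ind law]; rewrite outcome_fiber (ind (fun j => [set y j])) //.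
rewrite -prodEFin; apply: eq_bigr => j _.
by rewrite -bernoulli_prob_set1 // -law.
Qed.

Definition joint_weight Y Z (y z : {ffun 'I_M -> bool}) : R :=
  fine (P (outcome Y @^-1` [set y] `&` outcome Z @^-1` [set z])).

Lemma joint_weightE Y Z y z :
  (joint_weight Y Z y z)%:E = P (outcome Y @^-1` [set y] `&` outcome Z @^-1` [set z]).
Proof.
rewrite fineK // fin_num_measure //.
by apply: measurableI; exact: measurable_outcome.
Qed.

Lemma measurable_joint_event Y Z
    (Q : {ffun 'I_M -> bool} -> {ffun 'I_M -> bool} -> bool) :
  measurable [set w | Q (outcome Y w) (outcome Z w)].
Proof.
rewrite (_ : [set w | _] = \bigcup_(u in
    [set u : {ffun 'I_M -> bool} * {ffun 'I_M -> bool} | Q u.1 u.2])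
    (outcome Y @^-1` [set u.1] `&` outcome Z @^-1` [set u.2])).
  apply: fin_bigcup_measurable => [|u _]; first exact: finite_finset.
  by apply: measurableI; exact: measurable_outcome.
apply/seteqP; split => [w Qw|w [[y z] /= Qyz [-> ->]] //].
by exists (outcome Y w, outcome Z w).
Qed.

Lemma heads_oversize (y : {ffun 'I_M -> bool}) m : (M <= m)%N -> heads y m = heads y M.
Proof.
move=> Mm; apply: eq_bigl => j; rewrite ltn_ord.
by rewrite (leq_trans (ltn_ord j) Mm).
Qed.

(** Only the joint law of the two random vectors on a finite set matters. A pair of
outcomes of positive weight cannot lie in the null event where the partial sums
are in the wrong order, and an event of positive probability contains a pair of
outcomes of positive weight. *)
Lemma cookie_coupling_of_env_coupling Y Z : cookie_env p -> cookie_env q ->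
  env_coupling p q Y Z ->
  (exists m, (1 <= m <= M)%N /\
    (0 < P [set w | (partial_sum Y m w < partial_sum Z m w)%N])%E) ->
  cookie_coupling p q (joint_weight Y Z).
Proof.
move=> pe qe [Yp Zq ordered] [m [/andP[m1 mM] gap]].
have mY y := measurable_outcome Y y; have mZ z := measurable_outcome Z z.
have eventE (Q : rel nat) n : [set w | Q (partial_sum Y n w) (partial_sum Z n w)] =
    [set w | Q (heads (outcome Y w) n) (heads (outcome Z w) n)].
  by apply/seteqP; split => w /=; rewrite !partial_sum_outcome.
split.
- by move=> y z; rewrite -lee_fin joint_weightE measure_ge0.
- move=> y; apply: EFin_inj; rewrite -(outcome_law y pe Yp) -sumEFin.
  rewrite (total_probability P (f := outcome Z)) //.
  by apply: eq_bigr => z _; rewrite joint_weightE.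
- move=> z; apply: EFin_inj; rewrite -(outcome_law z qe Zq) -sumEFin.
  rewrite (total_probability P (f := outcome Y)) //.
  by apply: eq_bigr => y _; rewrite joint_weightE setIC.
- move=> y z; suff le_small n : (n <= M)%N -> 0 < joint_weight Y Z y z ->
      (heads y n <= heads z n)%N.
    move=> n pos; have [nM|Mn] := leqP n M; first exact: le_small.
    by rewrite !(@heads_oversize _ n) ?(ltnW Mn) //; exact: le_small.
  move=> nM; rewrite -lte_fin joint_weightE.
  case: n nM => [_ _|n nM]; first by rewrite /heads !big_pred0.
  apply: contraTT; rewrite -ltnNge => zy.
  have := ordered n.+1 nM; rewrite (eventE leq) => ord1.
  have mE := measurable_joint_event Y Z (fun y z => heads y n.+1 <= heads z n.+1)%N.
  have : P (~` [set w | (heads (outcome Y w) n.+1 <= heads (outcome Z w) n.+1)%N]) = 0%E.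
    by rewrite probability_setC // ord1 subee.
  move=> PC; rewrite -leNgt le_eqVlt; apply/orP; left; apply/eqP.
  apply: subset_measure0 PC; [exact: measurableI|exact: measurableC|].
  by move=> w [/= -> ->]; rewrite leqNgt zy.
have mE := measurable_joint_event Y Z (fun y z => heads y m < heads z m)%N.
apply: contrapT => none; move: gap; rewrite (eventE (fun a b => a < b)%N).
rewrite (total_probability P (f := fun w => (outcome Y w, outcome Z w))) //; last first.
  move=> [y z]; rewrite (_ : _ @^-1` _ =
      outcome Y @^-1` [set y] `&` outcome Z @^-1` [set z]).
    exact: measurableI.
  by apply/seteqP; split => w /= [-> ->].
rewrite big1 ?ltxx // => -[y z] _.
have [lt_yz|nlt] := boolP (heads y m < heads z m)%N; last first.
  rewrite (_ : _ `&` _ = set0) ?measure0 //.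
  by apply/seteqP; split => w //= [+ [yE zE]]; rewrite yE zE (negbTE nlt).
rewrite (_ : _ `&` _ = outcome Y @^-1` [set y] `&` outcome Z @^-1` [set z]); last first.
  apply/seteqP; split => w /=; first by case=> _ [-> ->].
  by move=> [-> ->].
apply/eqP; rewrite eq_le measure_ge0 andbT leNgt -joint_weightE lte_fin.
by apply/negP => pos; apply: none; exists y, z, m.
Qed.

End EnvCoupling.

(** * Reflection *)

Section Reflection.
Variable R : realType.

(** The environment for the walk [- X]: exchanging left and right turns the strength
[p j] into [1 - p j]. *)
Definition reflect_env (M : nat) (p : 'I_M -> R) (j : 'I_M) : R := 1 - p j.

Definition reflect_cookies (M : nat) (y : {ffun 'I_M -> bool}) : {ffun 'I_M -> bool} :=
  [ffun j => ~~ y j].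

Definition reflect_state (st : walk_state) : walk_state :=
  (- st.1, fun y => st.2 (- y)).

Lemma reflect_cookiesK M : involutive (@reflect_cookies M).
Proof. by move=> y; apply/ffunP => j; rewrite !ffunE negbK. Qed.

Lemma cookie_env_reflect M (p : 'I_M -> R) :
  cookie_env p -> cookie_env (reflect_env p).
Proof. by move=> pe j; have := pe j; rewrite /reflect_env => /andP[p0 p1]; lra. Qed.

Lemma bernoulli_weight_reflect (c : R) b :
  bernoulli_weight (1 - c) b = bernoulli_weight c (~~ b).
Proof. by case: b => //=; rewrite opprB addrC subrK. Qed.

Lemma heads_reflect M (y : {ffun 'I_M -> bool}) m :
  (heads (reflect_cookies y) m + heads y m = \sum_(j < M | j < m) 1)%N.
Proof. by rewrite -big_split; apply: eq_bigr => j _ /=; rewrite ffunE; case: (y j). Qed.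

(** Counting left arrows instead of right ones reverses the inequalities between
partial sums, so the coupled vectors change roles. *)
Lemma cookie_coupling_reflect M (p q : 'I_M -> R) pi : cookie_coupling p q pi ->
  cookie_coupling (reflect_env q) (reflect_env p)
    (fun y z => pi (reflect_cookies z) (reflect_cookies y)).
Proof.
move=> pq; have inj := inv_inj (@reflect_cookiesK M).
have weightE (r : 'I_M -> R) (y : {ffun 'I_M -> bool}) :
    \prod_j bernoulli_weight (reflect_env r j) (y j) =
    \prod_j bernoulli_weight (r j) (reflect_cookies y j).
  by apply: eq_bigr => j _; rewrite bernoulli_weight_reflect ffunE.
split.
- by move=> y z; exact: coupling_ge0 pq _ _.
- by move=> y; rewrite weightE -(coupling_snd pq) [RHS](reindex_inj inj).
- by move=> z; rewrite weightE -(coupling_fst pq) [RHS](reindex_inj inj).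
- move=> y z m pos; have := coupling_le pq m pos.
  by have := heads_reflect y m; have := heads_reflect z m; lia.
have [y [z [m [mM yz lt_yz]]]] := coupling_lt pq.
exists (reflect_cookies z), (reflect_cookies y), m; split => //.
  by rewrite !reflect_cookiesK.
by have := heads_reflect y m; have := heads_reflect z m; lia.
Qed.

Lemma cookie_reflect M (p : 'I_M -> R) j : cookie (reflect_env p) j = 1 - cookie p j.
Proof. by rewrite /cookie; case: insub => [i|] //; field. Qed.

Lemma move_reflect st b : move (reflect_state st) (~~ b) = reflect_state (move st b).
Proof.
rewrite /move /reflect_state /=; congr pair.
  by case: b => /=; rewrite ?opprD ?opprK.
by apply/funext => y; rewrite eqr_oppLR.
Qed.

Lemma path_weight_reflect M (p : 'I_M -> R) st ds :
  path_weight (reflect_env p) st ds =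
  path_weight p (reflect_state st) (map negb ds).
Proof.
elim: ds st => //= b ds IH st.
by rewrite IH move_reflect opprK cookie_reflect bernoulli_weight_reflect.
Qed.

Lemma origin_reflect : reflect_state origin = origin.
Proof. by rewrite /reflect_state /= oppr0. Qed.

Lemma trail_reflect ds : trail (map negb ds) = reflect_state (trail ds).
Proof.
rewrite /trail -{1}origin_reflect; elim: ds origin => //= b ds IH st.
by rewrite move_reflect IH.
Qed.

Lemma deviates_reflect (v e : R) N ds :
  deviates (- v) e N ds = deviates v e N (map negb ds).
Proof.
rewrite /deviates size_map; apply: eq_existsb => n.
rewrite -map_take trail_reflect /= mulrNz.
by rewrite mulNr opprK -opprB normrN opprK addrC.
Qed.

Lemma speed_in_probability_reflect M (p : 'I_M -> R) v :
  speed_in_probability p v -> speed_in_probability (reflect_env p) (- v).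
Proof.
move=> sp e dl e0 dl0; have [N NP] := sp e dl e0 dl0; exists N => t.
apply: le_trans (NP t); rewrite le_eqVlt; apply/orP; left; apply/eqP.
have inj : injective (fun ds : t.-tuple bool => [tuple of map negb ds]).
  by move=> ds ds' /(congr1 val) /= /(inj_map negb_inj) h; exact: val_inj.
rewrite [RHS](reindex_inj inj); apply: eq_bigr => ds _ /=.
by rewrite path_weight_reflect origin_reflect deviates_reflect.
Qed.

End Reflection.

Theorem theorem1p9 (R : realType) (M : nat) (M_gt0 : (0 < M)%N)
    (p q : 'I_M -> R) (p_env : cookie_env p) (q_env : cookie_env q)
    (vp vq : R) (p_speed : limiting_speed p vp) (q_speed : limiting_speed q vq)
    (pq : env_lt p q) :
  (vp = 0 /\ vq = 0) \/ vp < vq.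
Proof.
have sp := limiting_speed_in_probability p_env p_speed.
have sq := limiting_speed_in_probability q_env q_speed.
have [pi co] : exists pi, cookie_coupling p q pi.
  have [d [T [P [Y [Z [co gap]]]]]] := pq.
  exists (joint_weight Y Z).
  exact: cookie_coupling_of_env_coupling p_env q_env co gap.
have [vp0|vp0] := ltP 0 vp; first by right; exact: speed_lt co p_env sp sq vp0.
have [vq0|vq0] := ltP vq 0.
  right; rewrite -ltrN2.
  apply: (speed_lt (cookie_coupling_reflect co) (cookie_env_reflect q_env)
    (speed_in_probability_reflect sq) (speed_in_probability_reflect sp)).
  by rewrite oppr_gt0.
move: vp0; rewrite le_eqVlt => /orP[/eqP ->|vp0]; last first.
  by right; exact: lt_le_trans vq0.
by move: vq0; rewrite le_eqVlt => /orP[/eqP <-|]; [left|right].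
Qed.
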